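(* Let $(G,B)$ be a connected finite graph with boundary equipped with the unit weight, let $V(G)$ be its vertex set, and let $2\le i\le|B|$. Let $\sigma_i$ be the $i$-th Steklov eigenvalue of $(G,B)$. Then: (1) If $i$ does not divide $|V(G)|$, then $$\sigma_i\ge 2-2\cos\frac{\pi}{2k+1},\qquad k=\left\lfloor\frac{|V(G)|}{i}\right\rfloor.$$ When $|V(G)|\equiv1\pmod i$, equality holds in this inequality if and only if $k=1$ (i.e. $|V(G)|=i+1$) and $(G,B)$ is a star of degree $i$ with each arm of length $1$, with the end points of the arms being the boundary vertices. (2) If $i$ divides $|V(G)|$, then $$\sigma_i>\mathcal P(k,\lambda_i),\qquad k=\frac{|V(G)|}{i},$$ where $\lambda_i$ is the largest Laplacian eigenvalue of the path $P_i$ on $i$ vertices equipped with the unit weight, and $\mathcal P(k,\lambda)$ is the first Dirichlet eigenvalue of the weighted path $(P_{k+1},m,w)$ with boundary $\{0\}$, where $P_{k+1}$ is the path with vertices $0,1,\dots,k$, $m_j=1$ for $j=0,1,\dots,k$, $w_{12}=w_{23}=\cdots=w_{k-1,k}=1$ and $w_{01}=\lambda$.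
   Context: All graphs are finite and simple, and $G$ is connected, with vertex set $V=V(G)$ and edge set $E$. The unit weight means that vertex measure $m\equiv1$ on $V$ and edge weight $w\equiv1$ on $E$ are used; $w_{xy}=1$ if $\{x,y\}\in E$ and $w_{xy}=0$ otherwise. Graph with boundary: $(G,B)$ is a graph together with a nonempty set $B\subset V$ (the boundary) such that no two vertices of $B$ are adjacent and every vertex of $B$ is adjacent to some vertex of $\Omega:=V\setminus B$ (the interior). Laplacian: for a graph with vertex measure $m$ and edge weight $w$ (extended by zero to non-adjacent pairs), $\Delta u(x)=\frac1{m_x}\sum_{y}(u(y)-u(x))w_{xy}$; its Laplacian eigenvalues are the eigenvalues of $-\Delta$. Steklov eigenvalues: for $f\in\mathbb{R}^B$ let $u_f\in\mathbb{R}^V$ be the unique function with $u_f=f$ on $B$ and $\Delta u_f=0$ on $\Omega$. The Dirichlet-to-Neumann map $\Lambda:\mathbb{R}^B\to\mathbb{R}^B$ is $\Lambda f(x)=\sum_{y\in V}(u_f(x)-u_f(y))w_{xy}$ for $x\in B$. It is nonnegative and self-adjoint for $\langle f,g\rangle_B=\sum_{x\in B}f(x)g(x)$; its eigenvalues, counted with multiplicity, are $0=\sigma_1<\sigma_2\le\cdots\le\sigma_{|B|}$. First Dirichlet eigenvalue of the weighted path on $0,1,\dots,k$ with boundary $\{0\}$: the smallest $\mu$ for which there is a nonzero function $u$ on $\{0,\dots,k\}$ with $u(0)=0$ and $-\Delta u(j)=\mu u(j)$ for $j=1,\dots,k$. Star of degree $i$ with each arm of length $1$: the graph with a center vertex $o$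 and $i$ further vertices (the end points of the arms), whose edges are exactly those joining $o$ to each of the $i$ end points. *)

(* Defs.v *)
From HB Require Import structures.
From mathcomp Require Import all_boot all_order all_algebra.
From mathcomp Require Import all_classical all_reals all_analysis.

Set Implicit Arguments.
Unset Strict Implicit.
Unset Printing Implicit Defensive.

Import Order.TTheory GRing.Theory Num.Theory.

Local Open Scope classical_set_scope.
Local Open Scope ring_scope.

Section Graphs.
Variable T : finType.
Implicit Types (e : rel T) (B : {set T}).

Definition simple_graph e := symmetric e /\ irreflexive e.

Definition connected_graph e := forall x y, connect e x y.

Definition graph_boundary e B :=
  [/\ B != finset.set0,
      {in B &, forall x y, ~~ e x y} &
      {in B, forall x, exists2 y, y \notin B & e x y}].

(* The xor says that exactly one end of each edge is the center o. *)
Definition star_with_boundary e B (i : nat) :=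
  exists o : T, [/\ #|[set~ o]%SET| = i,
                    forall x y, e x y = (x == o) (+) (y == o) &
                    B = [set~ o]%SET].

End Graphs.

Definition path_edge (n : nat) : rel 'I_n :=
  fun x y => (x.+1 == y :> nat) || (y.+1 == x :> nat).

Section Laplacian.
Variables (R : realType) (T : finType).
Implicit Types (m u : T -> R) (w : T -> T -> R).

Definition unit_measure : T -> R := fun=> 1.

Definition unit_weight (e : rel T) : T -> T -> R := fun x y => (e x y)%:R.

Definition laplacian m w u (x : T) : R :=
  (m x)^-1 * \sum_y (u y - u x) * w x y.

Definition laplacian_eigenvalues m w : set R :=
  [set mu | exists u, (exists x, u x != 0) /\
                      forall x, - laplacian m w u x = mu * u x].

Definition dirichlet_eigenvalues m w (B : {set T}) : set R :=
  [set mu | exists u, [/\ exists x, u x != 0,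
                          forall x, x \in B -> u x = 0 &
                          forall x, x \notin B ->
                            - laplacian m w u x = mu * u x]].

End Laplacian.

Section Extrema.
Variable R : realType.

(* The default value 0 is reached only when A has no extremum; the sets of
   eigenvalues below are finite, and nonempty on nonempty paths (for
   dirichlet_path: if k > 0). *)
Definition smallest (A : set R) : R := xget 0 [set a | A a /\ lbound A a].

Definition largest (A : set R) : R := xget 0 [set a | A a /\ ubound A a].

End Extrema.

Section Spectrum.
Variable R : realType.

(* Matrix, acting on column vectors, of an operator on R^S in the basis of
   indicator functions. *)
Definition operator_mx (S : finType) (L : (S -> R) -> (S -> R)) : 'M[R]_#|S| :=
  \matrix_(i, j) L (fun x => (x == enum_val j)%:R) (enum_val i).

(* Nondecreasing list of the eigenvalues with multiplicity; it exists, and is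
   unique, when the characteristic polynomial splits over R, in particular
   for every symmetric matrix. *)
Definition spectrum (n : nat) (A : 'M[R]_n) : seq R :=
  xget [::] [set s : seq R | sorted <=%R s /\
                             char_poly A = \prod_(a <- s) ('X - a%:P)].

End Spectrum.

Section Steklov.
Variables (R : realType) (T : finType) (m : T -> R) (w : T -> T -> R).
Variable B : {set T}.

(* Such a u exists and is unique for positive m, symmetric nonnegative w and a
   nonempty B on a graph that is connected by the edges of positive weight. *)
Definition harmonic_extension (f : {x | x \in B} -> R) : T -> R :=
  xget (fun=> 0) [set u : T -> R | (forall x, u (val x) = f x) /\
                          forall x, x \notin B -> laplacian m w u x = 0].

Definition dirichlet_to_neumann (f : {x | x \in B} -> R)
    (x : {x | x \in B}) : R :=
  let u := harmonic_extension f in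
  \sum_y (u (val x) - u y) * w (val x) y.

(* Indexed from 1. *)
Definition steklov_eigenvalue (i : nat) : R :=
  (spectrum (operator_mx dirichlet_to_neumann))`_i.-1.

End Steklov.

Section Paths.
Variable R : realType.

Definition lambda_path (n : nat) : R :=
  largest (laplacian_eigenvalues (unit_measure R (T := 'I_n))
                                 (unit_weight R (@path_edge n))).

(* An edge of the path on 0, ..., k is {0, 1} iff one of its ends is 0. *)
Definition path_weight (k : nat) (lambda : R) : 'I_k.+1 -> 'I_k.+1 -> R :=
  fun x y => if path_edge x y then
               if (x == ord0) || (y == ord0) then lambda else 1
             else 0.

Definition dirichlet_path (k : nat) (lambda : R) : R :=
  smallest (dirichlet_eigenvalues (unit_measure R (T := 'I_k.+1))
                                  (path_weight lambda) [set ord0]%SET).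

End Paths.

(* Main.v *)
Require Import Defs.
From HB Require Import structures.
From mathcomp Require Import complex.
From mathcomp Require Import all_boot all_order all_algebra.
From mathcomp Require Import sesquilinear spectral ring lra zify.
From mathcomp Require Import all_classical all_reals all_analysis.

(** The harmonic extension of a boundary function has at least the mass of that
function, so i - 1 linear conditions on functions on V that force
c |u|^2 <= energy u give c <= sigma_i by the min-max principle, and c < sigma_i
if 0 < c < 1: in the case of equality the extension would vanish on the
interior, but then its energy is at least its mass since B is independent.

Conditions.  Sort the values of u on a connected set: every gap between
consecutive values is crossed by an edge, so the energy of u is at least that
of the sorted sequence on a path.  Hence u = 0 at one point gives the Dirichlet
bound of a path.  Cut a spanning tree from its leaves, each time removing the
first subtree with more than k vertices; since |V| < (k+1) i, the roots of at
most i - 1 subtrees are the required zeros.  If |V| = (k+1) i, the bound of the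
path with k edges is reached in the same way, unless the tree splits into i
subtrees of k + 1 vertices joined through their roots.  Then one requires u to
be proportional, on the roots, to a function of Rayleigh quotient at least
lambda_i for the graph of roots; such a function exists since this graph
contains a Hamiltonian path or a claw (whose top eigenvalue is 4). *)

Set Implicit Arguments.
Unset Strict Implicit.
Unset Printing Implicit Defensive.

Import Order.TTheory GRing.Theory Num.Theory.

Local Open Scope ring_scope.

(** * Spectral theorem and min-max principle for real symmetric matrices *)

Section SymmetricMatrices.
Local Open Scope sesquilinear_scope.

Lemma char_poly_conj (F : comUnitRingType) n (P D : 'M[F]_n) :
  P \in unitmx -> char_poly (invmx P *m D *m P) = char_poly D.
Proof.
move=> Pu; rewrite /char_poly /char_poly_mx.
have PK : map_mx (@polyC F) (invmx P) *m map_mx (@polyC F) P = 1%:M.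
  by rewrite -map_mxM mulVmx // map_mx1.
have -> : 'X%:M - map_mx (@polyC F) (invmx P *m D *m P) =
          map_mx (@polyC F) (invmx P) *m ('X%:M - map_mx (@polyC F) D) *m
          map_mx (@polyC F) P.
  by rewrite mulmxBr mulmxBl -[_ *m _%:M *m _]mulmxA mul_scalar_mx -scalemxAr
    PK scalemx1 !map_mxM.
by rewrite !det_mulmx mulrC mulrA -det_mulmx (mulmx1C PK) det1 mul1r.
Qed.

Variable R : rcfType.
Local Notation C := (complex R).
Local Notation toC := (real_complex R).

(** The matrix is hermitian over [C], where the spectral theorem is applied; its eigenvalues are
    real, hence equal to their real parts [d]. *)
Lemma symmetric_diagonalization n (M : 'M[R]_n) : M^T = M ->
  exists (P : 'M[C]_n) (d : 'I_n -> R),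
    P \is unitarymx /\
    map_mx toC M = invmx P *m diag_mx (\row_j toC (d j)) *m P.
Proof.
move=> Msym; set A := map_mx toC M.
have Ah : A \is hermsymmx.
  apply: realsym_hermsym.
    apply/is_hermitianmxP; rewrite expr0 scale1r map_mx_id //.
    by apply/matrixP => a b; rewrite !mxE -[in LHS]Msym mxE.
  by apply/mxOverP => a b; rewrite mxE complex_real.
have dr := hermitian_spectral_diag_real Ah.
exists (spectralmx A), (fun j => complex.Re (spectral_diag A 0 j)).
split; first exact: spectral_unitarymx.
have -> : \row_j toC (complex.Re (spectral_diag A 0 j)) = spectral_diag A.
  by apply/rowP => j; rewrite mxE RRe_real //; have /mxOverP := dr; apply.
exact: orthomx_spectralP (hermitian_normalmx Ah).
Qed.

Definition qform n (M : 'M[R]_n) (x : 'rV[R]_n) : R := (x *m M *m x^T) 0 0.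
Definition sqnorm n (x : 'rV[R]_n) : R := \sum_j x 0 j ^+ 2.

Lemma qformE n (M : 'M[R]_n) x :
  qform M x = \sum_b (\sum_a x 0 a * M a b) * x 0 b.
Proof. by rewrite /qform mxE; apply: eq_bigr => b _; rewrite !mxE. Qed.

Lemma Re_sum (I : Type) (r : seq I) (F : I -> C) :
  complex.Re (\sum_(i <- r) F i) = \sum_(i <- r) complex.Re (F i).
Proof. by apply: (big_morph (@complex.Re R)) => [[a b] [c d]|]. Qed.

Let Re_form n (M : 'M[R]_n) (z : 'rV[C]_n) :
  complex.Re ((z *m map_mx toC M *m z ^t* ) 0 0) =
  qform M (map_mx (@complex.Re R) z) + qform M (map_mx (@complex.Im R) z).
Proof.
rewrite !qformE mxE Re_sum -big_split /=; apply: eq_bigr => b _.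
rewrite !mxE big_distrl Re_sum !mulr_suml -big_split /=; apply: eq_bigr => a _.
by rewrite !mxE; case: (z 0 a) (z 0 b) => [u1 u2] [v1 v2] /=; ring.
Qed.

Let cnorm (w : C) : R := complex.Re w ^+ 2 + complex.Im w ^+ 2.

Let cnorm_ge0 w : 0 <= cnorm w.
Proof. by rewrite addr_ge0 ?sqr_ge0. Qed.

Let Re_diag_form n (d : 'I_n -> R) (Y : 'rV[C]_n) :
  complex.Re ((Y *m diag_mx (\row_j toC (d j)) *m Y ^t* ) 0 0) =
  \sum_j d j * cnorm (Y 0 j).
Proof.
rewrite mxE Re_sum; apply: eq_bigr => b _.
rewrite mul_mx_diag !mxE; case: (Y 0 b) => [u v] /=; rewrite /cnorm /=; ring.
Qed.

Let qform1 n (x : 'rV[R]_n) : qform 1%:M x = sqnorm x.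
Proof.
by rewrite /qform mulmx1 mxE; apply: eq_bigr => j _; rewrite mxE expr2.
Qed.

Let unitary_form n (M : 'M[R]_n) (P : 'M[C]_n) (d : 'I_n -> R) (Y : 'rV[C]_n) :
  P \is unitarymx ->
  map_mx toC M = invmx P *m diag_mx (\row_j toC (d j)) *m P ->
  let x := map_mx (@complex.Re R) (Y *m P) in
  let y := map_mx (@complex.Im R) (Y *m P) in
  qform M x + qform M y = \sum_j d j * cnorm (Y 0 j).
Proof.
move=> Pun MP x y; rewrite -Re_form -Re_diag_form MP.
have PP := unitarymx_unit Pun.
have -> : (Y *m P) ^t* = invmx P *m Y ^t*.
  by rewrite invmx_unitary // trmx_mul map_mxM.
by rewrite !mulmxA !(mulmxK PP).
Qed.

Let unitary_norm n (P : 'M[C]_n) (Y : 'rV[C]_n) :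
  P \is unitarymx ->
  sqnorm (map_mx (@complex.Re R) (Y *m P)) +
    sqnorm (map_mx (@complex.Im R) (Y *m P)) = \sum_j cnorm (Y 0 j).
Proof.
move=> Pun; rewrite -!qform1.
have -> := @unitary_form n 1%:M P (fun=> 1) Y Pun _.
  by apply: eq_bigr => j _; rewrite mul1r.
have -> : (\row_(j < n) toC 1 : 'rV[C]_n) = const_mx 1.
  by apply/rowP => j; rewrite !mxE.
rewrite diag_const_mx mulmx1 mulVmx ?unitarymx_unit //.
by apply/matrixP => a b; rewrite !mxE; case: (a == b).
Qed.

Lemma sqnorm_ge0 n (x : 'rV[R]_n) : 0 <= sqnorm x.
Proof. by apply: sumr_ge0 => j _; exact: sqr_ge0. Qed.

Lemma sqnorm_eq0 n (x : 'rV[R]_n) : (sqnorm x == 0) = (x == 0).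
Proof.
apply/idP/eqP => [|->]; last by rewrite /sqnorm big1 // => j _;
  rewrite mxE expr0n.
rewrite psumr_eq0 => [/allP h|j _]; last exact: sqr_ge0.
apply/rowP => j; rewrite mxE; apply/eqP; rewrite -sqrf_eq0.
by apply: h; rewrite mem_index_enum.
Qed.

(* The test vector of part (3) is the real or the imaginary part of a complex
   combination of eigenvectors. *)
Lemma symmetric_spectrum n (M : 'M[R]_n) : M^T = M ->
  exists d : 'I_n -> R,
  [/\ char_poly M = \prod_j ('X - (d j)%:P),
      forall x, exists2 t : 'I_n -> R, forall j, 0 <= t j &
        sqnorm x = \sum_j t j /\ qform M x = \sum_j d j * t j &
      forall (J : {set 'I_n}) (s : R) m (K : 'M[R]_(n, m)), (m < #|J|)%N ->
        (forall j, j \in J -> d j <= s) ->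
        exists x, [/\ x != 0, x *m K = 0 & qform M x <= s * sqnorm x]].
Proof.
move=> /symmetric_diagonalization[P [d [Pun MP]]]; exists d.
have PP := unitarymx_unit Pun; split.
- apply: (map_poly_inj toC).
  rewrite map_char_poly MP char_poly_conj // char_poly_trig ?diag_mx_trig //.
  rewrite rmorph_prod /=; apply: eq_bigr => j _.
  by rewrite rmorphB /= map_polyX map_polyC /= !mxE eqxx mulr1n.
- move=> x; pose z : 'rV[C]_n := map_mx toC x.
  have zE : z = z *m invmx P *m P by rewrite mulmxKV.
  have Rz : map_mx (@complex.Re R) z = x by apply/rowP => j; rewrite !mxE.
  have Iz : map_mx (@complex.Im R) z = 0 by apply/rowP => j; rewrite !mxE.
  (* The rows of [P] are unit eigenvectors; [t j] is the squared modulus of the coordinate of [x]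
     along the [j]-th one. *)
  exists (fun j => cnorm ((z *m invmx P) 0 j)) => //.
  have := unitary_norm (z *m invmx P) Pun; rewrite -zE Rz Iz => <-.
  have := unitary_form (z *m invmx P) Pun MP; rewrite /= -zE Rz Iz => <-.
  have -> : sqnorm (0 : 'rV[R]_n) = 0 by apply/eqP; rewrite sqnorm_eq0.
  have -> : qform M 0 = 0 by rewrite /qform !mul0mx mxE.
  by rewrite !addr0.
move=> J s m K mJ dJ.
(* The rows of [Q *m P] are the eigenvectors with index in [J]; as [m < #|J|], some nonzero
   combination [y] of them satisfies the conditions [K]. *)
pose Q : 'M[C]_(#|J|, n) := rowsub (@enum_val _ (mem J)) 1%:M.
pose L := Q *m P *m map_mx toC K.
have [y yn0 yL] : exists2 y : 'rV_#|J|, y != 0 & y *m L = 0.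
  have kn0 : kermx L != 0.
    rewrite -mxrank_eq0 mxrank_ker subn_eq0 -ltnNge.
    exact: leq_ltn_trans (rank_leq_col _) mJ.
  have /rowV0Pn[y yk yn0] := kn0.
  by exists y => //; apply/sub_kermxP.
pose Y := y *m Q; pose z := Y *m P.
have Yval j : j \notin J -> Y 0 j = 0.
  move=> jJ; rewrite mxE big1 // => a _; rewrite !mxE.
  case: eqP => [jE|]; last by rewrite mulr0.
  by rewrite -jE enum_valP in jJ.
have Yn0 : Y != 0.
  apply: contra yn0 => /eqP Y0; apply/eqP/rowP => a.
  have := congr1 (fun v : 'rV_n => v 0 (enum_val a)) Y0; rewrite /Y !mxE.
  rewrite (bigD1 a) //= big1 => [|b ba]; last first.
    by rewrite !mxE (inj_eq enum_val_inj) (negPf ba) mulr0.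
  by rewrite !mxE eqxx mulr1 addr0.
have zK : z *m map_mx toC K = 0 by rewrite /z /Y -!mulmxA !mulmxA -[RHS]yL
  !mulmxA.
pose zr := map_mx (@complex.Re R) z; pose zi := map_mx (@complex.Im R) z.
have zrK : zr *m K = 0.
  apply/rowP => j; have := congr1 (fun v : 'rV_m => complex.Re (v 0 j)) zK.
  rewrite !mxE Re_sum => e0; rewrite -[RHS]e0; apply: eq_bigr => a _.
  rewrite [zr _ _]mxE [map_mx _ _ _ _]mxE.
  by case: (z 0 a) => u v /=; rewrite mulr0 subr0.
have ziK : zi *m K = 0.
  apply/rowP => j.
  have := congr1 (fun v : 'rV_m => complex.Re (- 'i%C * v 0 j)) zK.
  rewrite !mxE mulr_sumr Re_sum mulr0 => e0; rewrite -[RHS]e0.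
  apply: eq_bigr => a _; rewrite [zi _ _]mxE [map_mx _ _ _ _]mxE.
  by case: (z 0 a) => u v /=; ring.
have le_s : qform M zr + qform M zi <= s * (sqnorm zr + sqnorm zi).
  rewrite /zr /zi (unitary_norm _ Pun) (unitary_form _ Pun MP) mulr_sumr.
  apply: ler_sum => j _; have [jJ|/Yval ->] := boolP (j \in J).
    by rewrite ler_wpM2r ?dJ.
  by rewrite /cnorm /= expr0n /= !addr0 !mulr0.
have zn0 : (zr != 0) || (zi != 0).
  rewrite -negb_and; apply: contra Yn0 => /andP[/eqP zr0 /eqP zi0].
  suff z0 : z = 0 by rewrite -(mulmxK PP Y) -/z z0 mul0mx.
  apply/rowP => j; move: (congr1 (fun v : 'rV_n => v 0 j) zr0).
  move: (congr1 (fun v : 'rV_n => v 0 j) zi0).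
  rewrite /zr /zi ![map_mx _ z _ _]mxE !(mxE const_mx_key).
  by case: (z 0 j) => u v /= -> ->.
(* One of the two parts satisfies the bound because the sum does. It must also be nonzero: if
   [zr = 0], the whole inequality falls to [zi], and a strict inequality for [zi] excludes
   [zi = 0]. *)
have [zr_le|zr_gt] := lerP (qform M zr) (s * sqnorm zr).
  have [zr0|zr0] := eqVneq zr 0; last by exists zr.
  exists zi; split=> //; first by move: zn0; rewrite zr0 eqxx.
  move: le_s; have -> : sqnorm zr = 0 by apply/eqP; rewrite sqnorm_eq0 zr0.
  have -> : qform M zr = 0 by rewrite zr0 /qform !mul0mx mxE.
  by rewrite !add0r.
have zi_lt : qform M zi < s * sqnorm zi by move: le_s zr_gt; lra.
exists zi; split=> //; last exact: ltW.
apply: contraL zi_lt => /eqP ->; rewrite /qform !mul0mx mxE.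
have -> : sqnorm (0 : 'rV[R]_n) = 0 by apply/eqP; rewrite sqnorm_eq0.
by rewrite mulr0 ltxx.
Qed.

End SymmetricMatrices.

(** * Rooted trees and the energy of functions on them *)

Section Energy.
Import boot.fintype boot.finset.
Variables (R : realFieldType) (V : finType) (e : rel V).
Hypothesis e_sym : symmetric e.
Implicit Types (A D S : {set V}) (u : V -> R) (r x y : V).

(* Sets carrying a spanning tree rooted at r, built by hanging trees at r. *)
Inductive rooted_tree : V -> {set V} -> Prop :=
| RootedSingle r : rooted_tree r [set r]
| RootedGraft r x A D : rooted_tree r A -> rooted_tree x D ->
    [disjoint A & D] -> e r x -> rooted_tree r (A :|: D).

Lemma rooted_tree_root r A : rooted_tree r A -> r \in A.
Proof. by elim=> [r0|r0 x A0 D _ rA _ _ _ _]; rewrite !inE ?rA. Qed.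

Lemma rooted_tree_gt0 r A : rooted_tree r A -> (0 < #|A|)%N.
Proof. by move=> /rooted_tree_root rA; rewrite card_gt0; apply/set0Pn;
  exists r. Qed.

Lemma disjoint_setU1l z A D : z \notin D -> [disjoint A & D] ->
  [disjoint z |: A & D].
Proof.
rewrite -!setI_eq0 setIUl => zD /eqP ->.
by rewrite setU0 setI_eq0 disjoints1.
Qed.

Lemma rooted_tree_extend r A y z : rooted_tree r A -> y \in A -> z \notin A ->
  e y z -> rooted_tree r (z |: A).
Proof.
move=> rA; elim: rA y => {r A} [r|r x A D rA IHA xD IHD dAD erx] y.
  rewrite !inE => /eqP-> zr erz; rewrite setUC; apply: RootedGraft erz.
  - exact: RootedSingle.
  - exact: RootedSingle.
  - by rewrite disjoints1 inE eq_sym.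
rewrite !inE => yAD; rewrite negb_or => /andP[zA zD] eyz.
have [yA|yA] := boolP (y \in A).
  rewrite setUA; apply: RootedGraft (IHA _ yA zA eyz) xD _ erx.
  exact: disjoint_setU1l.
rewrite (negPf yA) /= in yAD; rewrite setUCA.
apply: RootedGraft rA (IHD _ yAD zD eyz) _ erx.
by rewrite disjoint_sym disjoint_setU1l // disjoint_sym.
Qed.

Lemma rooted_tree_setT r : connected_graph e -> rooted_tree r setT.
Proof.
move=> conn; suff h n : (n < #|V|)%N ->
    exists2 A, rooted_tree r A & #|A| = n.+1.
  have V0 : (0 < #|V|)%N by apply/card_gt0P; exists r.
  have [A rA cA] : exists2 A, rooted_tree r A & #|A| = #|V|.-1.+1.
    by apply: h; rewrite prednK.
  have AT : A = [set: V].
    by apply/eqP; rewrite eqEcard subsetT cardsT cA prednK /=.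
  by rewrite -AT.
elim: n => [|n IHn] ltn.
  by exists [set r]; [exact: RootedSingle | rewrite cards1].
have [A rA cA] := IHn (ltnW ltn).
have [z zA] : exists z, z \notin A.
  apply/existsP; rewrite -negb_forall; apply/negP => /forallP allA.
  suff /eqP AT : A == [set: V] by rewrite -cardsT -AT cA ltnn in ltn.
  by rewrite eqEsubset subsetT; apply/subsetP => z _.
have /connectP[p pP zE] := conn r z.
have [x [y [xA yA exy]]] : exists x y, [/\ x \in A, y \notin A & e x y].
  have := rooted_tree_root rA; rewrite zE in zA.
  move: (r) pP zA {zE rA} => r'; elim: p r' => [|y p IHp] x /=.
    by move=> _ /negPf ->.
  move=> /andP[exy yp] lA xA; have [yA|yA] := boolP (y \in A).
    exact: IHp yp lA yA.
  by exists x, y.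
exists (y |: A); first exact: rooted_tree_extend rA xA yA exy.
by rewrite cardsU1 yA cA.
Qed.

(** If [r] and [x] lie on different sides of [X], the grafting edge crosses; otherwise one of the
    two subtrees meets both sides. *)
Lemma rooted_tree_crossing r A (X : pred V) : rooted_tree r A ->
  (exists2 x, x \in A & X x) -> (exists2 y, y \in A & ~~ X y) ->
  exists x y, [/\ x \in A, y \in A, X x, ~~ X y & e x y].
Proof.
elim=> {r A} [r|r x A D rA IHA xD IHD dAD erx].
  by move=> [x /set1P-> Xr] [y /set1P->]; rewrite Xr.
have sA z : z \in A -> z \in A :|: D by rewrite inE => ->.
have sD z : z \in D -> z \in A :|: D by rewrite inE orbC => ->.
have rA0 := rooted_tree_root rA; have xD0 := rooted_tree_root xD.
have IHA' y z : y \in A -> z \in A -> X y -> ~~ X z ->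
    exists x y, [/\ x \in A :|: D, y \in A :|: D, X x, ~~ X y & e x y].
  move=> yA zA Xy Xz; have [|| a [b [aA bA ? ? ?]]] := IHA.
  - by exists y.
  - by exists z.
  - by exists a, b; split; auto.
have IHD' y z : y \in D -> z \in D -> X y -> ~~ X z ->
    exists x y, [/\ x \in A :|: D, y \in A :|: D, X x, ~~ X y & e x y].
  move=> yA zA Xy Xz; have [|| a [b [aA bA ? ? ?]]] := IHD.
  - by exists y.
  - by exists z.
  - by exists a, b; split; auto.
move=> [y /setUP yAD Xy] [z /setUP zAD Xz].
have [Xr|Xr] := boolP (X r); have [Xx|Xx] := boolP (X x).
- by case: zAD => zM; [apply: IHA' rA0 zM _ _ | apply: IHD' xD0 zM _ _].
- by exists r, x; split; auto.
- by exists x, r; split; rewrite 1?e_sym; auto.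
- by case: yAD => yM; [apply: IHA' yM rA0 _ _ | apply: IHD' yM xD0 _ _].
Qed.

(** Every edge inside [A] appears in both orders, hence the division by 2. All edges of [e] inside
    [A] count, not only those of a spanning tree. *)
Definition energy A u : R :=
  (\sum_(x in A) \sum_(y in A) (e x y)%:R * (u x - u y) ^+ 2) / 2.

Definition mass A u : R := \sum_(x in A) u x ^+ 2.

Let edge_ge0 u x y : 0 <= (e x y)%:R * (u x - u y) ^+ 2.
Proof. by rewrite mulr_ge0 ?sqr_ge0 ?ler0n. Qed.

Lemma energy_ge0 A u : 0 <= energy A u.
Proof.
by rewrite divr_ge0 ?ler0n // sumr_ge0 // => x _; apply: sumr_ge0 => y _.
Qed.

Lemma mass_ge0 A u : 0 <= mass A u.
Proof. by apply: sumr_ge0 => x _; exact: sqr_ge0. Qed.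

Let sumU A D (F : V -> R) : [disjoint A & D] ->
  \sum_(y in A :|: D) F y = \sum_(y in A) F y + \sum_(y in D) F y.
Proof. by move=> dAD; rewrite -bigU //; apply: eq_bigl => x; rewrite !inE. Qed.

Lemma massU A D u : [disjoint A & D] -> mass (A :|: D) u = mass A u + mass D u.
Proof. exact: sumU. Qed.

Lemma mass1 x u : mass [set x] u = u x ^+ 2.
Proof. by rewrite /mass big_set1. Qed.

Lemma energyU A D u : [disjoint A & D] ->
  energy (A :|: D) u = energy A u + energy D u +
    \sum_(x in A) \sum_(y in D) (e x y)%:R * (u x - u y) ^+ 2.
Proof.
move=> dAD; rewrite /energy.
rewrite sumU // !(eq_bigr _ (fun x _ => sumU _ dAD)) !big_split /=.
have -> : \sum_(x in D) \sum_(y in A) (e x y)%:R * (u x - u y) ^+ 2 =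
          \sum_(x in A) \sum_(y in D) (e x y)%:R * (u x - u y) ^+ 2.
  rewrite exchange_big; apply: eq_bigr => x _; apply: eq_bigr => y _.
  by rewrite e_sym; congr (_ * _); rewrite -sqrrN opprB.
by field.
Qed.

Lemma energyU_edge A D u x y : [disjoint A & D] -> x \in A -> y \in D ->
  e x y ->
  energy A u + energy D u + (u x - u y) ^+ 2 <= energy (A :|: D) u.
Proof.
move=> dAD xA yD exy; rewrite energyU // lerD2l (bigD1 x) //= (bigD1 y) //=.
rewrite exy mul1r -addrA lerDl addr_ge0 ?sumr_ge0 // => z _.
by apply: sumr_ge0 => t _.
Qed.

Lemma eq_energy A u v : {in A, u =1 v} -> energy A u = energy A v.
Proof.
move=> uv; congr (_ / _); apply: eq_bigr => x xA; apply: eq_bigr => y yA.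
by rewrite !uv.
Qed.

(** Reverse triangle inequality. It allows replacing u by |u|, whose least value on a tree is at
    most |u y| for any chosen [y]. *)
Lemma energy_norm A u : energy A (fun x => `|u x|) <= energy A u.
Proof.
rewrite ler_wpM2r ?invr_ge0 ?ler0n //.
apply: ler_sum => x _; apply: ler_sum => y _; rewrite ler_wpM2l ?ler0n //.
rewrite -[leRHS]real_normK ?num_real // -[leLHS]real_normK ?num_real //.
by rewrite ler_sqr ?nnegrE ?normr_ge0 // ler_dist_dist.
Qed.

Lemma mass_norm A u : mass A (fun x => `|u x|) = mass A u.
Proof. by apply: eq_bigr => x _; rewrite real_normK ?num_real. Qed.

(** No value of [u] lies strictly between [a] and [b]. Raising the truncation level from [a] to [b]
    decreases no term of the energy, and by connectedness some edge crosses the gap and gains at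
    least [(b - a) ^+ 2]. *)
Lemma energy_truncation r A u (a b : R) : rooted_tree r A -> a <= b ->
  {in A, forall x, u x <= a \/ b <= u x} ->
  (exists2 x, x \in A & u x <= a) -> (exists2 y, y \in A & b <= u y) ->
  energy A (fun x => Num.min (u x) a) + (b - a) ^+ 2 <=
  energy A (fun x => Num.min (u x) b).
Proof.
move=> rA; rewrite le_eqVlt => /orP[/eqP -> |ab] uab [x0 x0A x0a] [y0 y0A y0b].
  by rewrite subrr expr0n addr0.
have [||x [y [xA yA xa ya exy]]] :=
    rooted_tree_crossing (X := fun x => u x <= a) rA.
- by exists x0.
- by exists y0 => //; rewrite -ltNge (lt_le_trans ab).
have yb : b <= u y by case: (uab y yA) => // h; rewrite h in ya.
have low t : t <= a -> [/\ Num.min t a = t, Num.min t b = t & t <= a].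
  by move=> ta; rewrite !min_l // (le_trans ta (ltW ab)).
have high t : b <= t -> [/\ Num.min t a = a, Num.min t b = b & b <= t].
  by move=> tb; rewrite !min_r // (le_trans (ltW ab)).
pose F t z w := (e z w)%:R * (Num.min (u z) t - Num.min (u w) t) ^+ 2.
have FF z w : z \in A -> w \in A -> F a z w <= F b z w.
  move=> zA wA; rewrite ler_wpM2l ?ler0n //.
  case: (uab z zA) => [/low|/high] [-> -> ?];
    case: (uab w wA) => [/low|/high] [-> -> ?] //.
  - by rewrite -[leLHS]sqrrN -[leRHS]sqrrN !opprB ler_sqr ?nnegrE; lra.
  - by rewrite ler_sqr ?nnegrE; lra.
  - by rewrite !subrr.
pose G z w := F b z w - F a z w.
have xny : x != y by apply: contraNneq ya => <-.
(* The crossing edge counts twice, as [G x y] and [G y x], which makes up for the division by 2 in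
   the energy. *)
have G2 : 2 * (b - a) ^+ 2 <= \sum_(z in A) \sum_(w in A) G z w.
  have G0 z w : z \in A -> w \in A -> 0 <= G z w.
    by move=> zA wA; rewrite subr_ge0 FF.
  have one z w : z \in A -> w \in A -> G z w <= \sum_(t in A) G z t.
    move=> zA wA; rewrite (bigD1 w) //= lerDl sumr_ge0 // => t /andP[tA _].
    exact: G0.
  have s2 : 0 <= \sum_(i in A | (i != x) && (i != y)) \sum_(w in A) G i w.
    by apply: sumr_ge0 => z /andP[zA _]; apply: sumr_ge0 => w wA; exact: G0.
  have E2 : \sum_(i in A) \sum_(w in A) G i w = \sum_(w in A) G x w +
      (\sum_(w in A) G y w +
       \sum_(i in A | (i != x) && (i != y)) \sum_(w in A) G i w).
    rewrite (bigD1 x) //=; congr (_ + _); rewrite (bigD1 y) /=; last first.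
      by rewrite yA eq_sym.
    by congr (_ + _); apply: eq_bigl => i; rewrite andbA.
  have := one x y xA yA; have := one y x yA xA; rewrite E2.
  have Gxy : (b - a) ^+ 2 <= G x y /\ (b - a) ^+ 2 <= G y x.
    have [xa1 xa2 _] := low _ xa; have [yb1 yb2 _] := high _ yb.
    (* This product is half the excess of [(b - u x) ^+ 2 - (a - u x) ^+ 2] over [(b - a) ^+ 2]. *)
    have : 0 <= (a - u x) * (b - a) by apply: mulr_ge0; rewrite subr_ge0 // ltW.
    by rewrite /G /F [e y x]e_sym exy !mul1r xa1 xa2 yb1 yb2; split; lra.
  case: Gxy; lra.
have E : \sum_(z in A) \sum_(w in A) G z w =
    \sum_(z in A) \sum_(w in A) F b z w - \sum_(z in A) \sum_(w in A) F a z w.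
  rewrite -sumrB; apply: eq_bigr => z _; by rewrite -sumrB.
rewrite /energy -/(F _ _ _); move: G2; rewrite E /F; lra.
Qed.

(** [a] lists the values of [u] on [A] in nondecreasing order, with multiplicity. The energy bound
    adds up the gaps, raising the truncation level from each value to the next. *)
Lemma sorted_profile r A u : rooted_tree r A ->
  exists a : nat -> R,
  [/\ {in A, forall y, a 0%N <= u y},
      {in A &, forall y z, y != z -> a 1%N <= u y \/ a 1%N <= u z},
      (forall j, (j < #|A|)%N -> exists2 y, y \in A & a j = u y),
      mass A u = \sum_(0 <= j < #|A|) a j ^+ 2 &
      \sum_(0 <= j < #|A|.-1) (a j.+1 - a j) ^+ 2 <= energy A u].
Proof.
move=> rA; have A0 := rooted_tree_gt0 rA.
pose s := sort <=%R [seq u x | x <- enum A].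
have ss : size s = #|A| by rewrite size_sort size_map cardE.
have srt : sorted <=%R s by exact: sort_le_sorted.
have mem_s y : y \in A -> u y \in s.
  by move=> yA; rewrite mem_sort; apply: map_f; rewrite mem_enum.
have s_mem j : (j < #|A|)%N -> exists2 y, y \in A & nth 0 s j = u y.
  rewrite -ss => /(mem_nth 0); rewrite mem_sort => /mapP[y].
  by rewrite mem_enum => yA ->; exists y.
have s_le i j : (i <= j < #|A|)%N -> nth 0 s i <= nth 0 s j.
  by rewrite -ss => /andP[ij js]; apply: le_sorted_leq_nth;
    rewrite ?inE // (leq_ltn_trans ij).
have s_ge y j : y \in A -> (j.+1 < #|A|)%N ->
  u y <= nth 0 s j \/ nth 0 s j.+1 <= u y.
  move=> yA jA; have /(nthP 0)[m ms <-] := mem_s y yA; rewrite ss in ms.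
  have [mj|jm] := leqP m j; [left|right]; apply: s_le; first by rewrite mj ltnW.
  by rewrite jm.
exists (nth 0 s); split => //.
- move=> y yA; have /(nthP 0)[m ms <-] := mem_s y yA.
  by apply: s_le; rewrite -ss.
- move=> y z yA zA yz.
  have [|lty] := leP (nth 0 s 1) (u y); first by left.
  have [|ltz] := leP (nth 0 s 1) (u z); first by right.
  (* Otherwise two entries of the sorted list would lie strictly below its second entry. *)
  suff /(nth_count_lt 0 srt) : (1 < count (< nth 0 s 1%N)%R s)%N by rewrite
    ltxx.
  have -> : count (< nth 0 s 1%N)%R s = count (fun x =>
    u x < nth 0 s 1%N) (enum A).
    rewrite (permP (permEl (perm_sort _ _))) count_map; exact: eq_count.
  rewrite -size_filter; have <- : size [:: y; z] = 2%N by [].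
  apply: uniq_leq_size => [|t]; first by rewrite /= inE yz.
  by rewrite !inE mem_filter mem_enum => /orP[] /eqP ->; rewrite ?lty ?ltz.
- transitivity (\sum_(x <- s) x ^+ 2); last by rewrite (big_nth 0) ss.
  by rewrite (perm_big _ (permEl (perm_sort _ _))) big_map big_enum.
have claim m : (m < #|A|)%N -> \sum_(0 <=
  j < m) (nth 0 s j.+1 - nth 0 s j) ^+ 2 <=
    energy A (fun x => Num.min (u x) (nth 0 s m)).
  elim: m => [_|m IHm mA]; first by rewrite big_nil energy_ge0.
  rewrite big_nat_recr //=; have /IHm IH := ltnW mA.
  apply: le_trans (_ : _ <= energy A (fun x => Num.min (u x) (nth 0 s m)) +
    (nth 0 s m.+1 - nth 0 s m) ^+ 2) _; first by rewrite lerD2r.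
  apply: energy_truncation rA _ _ _ _.
  - by apply: s_le; rewrite leqnSn.
  - by move=> x xA; exact: s_ge.
  - by have [y yA ->] := s_mem m (ltnW mA); exists y.
  - by have [y yA ->] := s_mem _ mA; exists y.
apply: le_trans (claim _ _) _; first by rewrite prednK.
rewrite (@eq_energy A _ u) // => x xA; rewrite minEle.
have /(nthP 0)[m ms <-] := mem_s x xA; rewrite ss in ms.
by rewrite s_le // -ltnS prednK // ms leqnn.
Qed.

(* Lower bound c on the first Dirichlet eigenvalue of the unit path on
   0, ..., k with boundary {0}. *)
Definition path_bound (k : nat) (c : R) := forall a : nat -> R, a 0%N = 0 ->
  c * \sum_(0 <= j < k) a j.+1 ^+ 2 <= \sum_(0 <= j < k) (a j.+1 - a j) ^+ 2.

(** A sequence on the shorter path is prolonged by its last value: the energy stays the same and the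
    mass does not decrease. *)
Lemma path_bound_le m k c : 0 <= c -> (m <= k)%N -> path_bound k c ->
  path_bound m c.
Proof.
move=> c0 mk H a a0; pose b j := a (minn j m).
have := H b; rewrite /b min0n => /(_ a0).
rewrite !(big_cat_nat (leq0n m) mk) /=.
have e1 : \sum_(0 <= j < m) a (minn j.+1 m) ^+ 2 = \sum_(0 <=
  j < m) a j.+1 ^+ 2.
  by apply: eq_big_nat => j /= jm; rewrite (minn_idPl jm).
have e2 : \sum_(0 <= j < m) (a (minn j.+1 m) - a (minn j m)) ^+ 2 =
          \sum_(0 <= j < m) (a j.+1 - a j) ^+ 2.
  by apply: eq_big_nat => j /= jm; rewrite (minn_idPl jm) (minn_idPl (ltnW jm)).
have e3 : \sum_(m <= j < k) (a (minn j.+1 m) - a (minn j m)) ^+ 2 = 0.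
  rewrite big_nat_cond big1 // => j /andP[/andP[mj _] _].
  by rewrite (minn_idPr mj) (minn_idPr (leqW mj)) subrr expr0n.
rewrite e1 e2 e3 addr0; apply: le_trans; rewrite ler_wpM2l // lerDl.
by apply: sumr_ge0 => j _; exact: sqr_ge0.
Qed.

(** The last hypothesis is the bound for a path with [#|A|] free vertices, fixed to a boundary
    vertex by an edge of weight [l]. It is applied to the sorted values of |u|, the first of which
    is at most |u y|. *)
Lemma tree_weighted_path_bound r A u y (c l : R) : rooted_tree r A -> y \in A ->
  0 <= l ->
  (forall a : nat -> R, c * \sum_(0 <= j < #|A|) a j ^+ 2 <=
    l * a 0%N ^+ 2 + \sum_(0 <= j < #|A|.-1) (a j.+1 - a j) ^+ 2) ->
  c * mass A u <= energy A u + l * u y ^+ 2.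
Proof.
move=> rA yA l0 H.
have [a [a0 _ aval m_a g_a]] := sorted_profile (fun x => `|u x|) rA.
rewrite mass_norm in m_a; rewrite m_a.
apply: le_trans (H a) _; rewrite addrC lerD //.
  exact: le_trans g_a (energy_norm _ _).
rewrite ler_wpM2l // -[leRHS]real_normK ?num_real // ler_sqr ?nnegrE ?a0 //.
by have [z zA ->] := aval 0%N (rooted_tree_gt0 rA).
Qed.

(** Here [u y ^+ 2] stands for the energy of an edge from [y] to a vertex where [u] vanishes. *)
Lemma tree_path_bound r A u y k (c : R) : rooted_tree r A -> y \in A ->
  0 <= c -> path_bound k c -> (#|A| <= k)%N ->
  c * mass A u <= energy A u + u y ^+ 2.
Proof.
move=> rA yA c0 kc Ak; rewrite -[u y ^+ 2]mul1r.
have A0 := rooted_tree_gt0 rA.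
apply: (tree_weighted_path_bound u rA yA ler01) => a.
have := path_bound_le c0 Ak kc (a :=
  fun j => if j is j'.+1 then a j' else 0) erefl.
move=> /le_trans; apply; rewrite -{1}(prednK A0).
by rewrite big_nat_recl //= subr0 mul1r.
Qed.

(** The zero is now inside the tree and is the least value of |u|, so the tree may have [k.+1]
    vertices. *)
Lemma tree_zero_bound r A u y k (c : R) : rooted_tree r A -> y \in A ->
  0 <= c -> path_bound k c -> (#|A| <= k.+1)%N -> u y = 0 ->
  c * mass A u <= energy A u.
Proof.
move=> rA yA c0 kc Ak uy0; have A0 := rooted_tree_gt0 rA.
have [a [a0 _ aval m_a g_a]] := sorted_profile (fun x => `|u x|) rA.
rewrite mass_norm in m_a; rewrite m_a.
apply: le_trans (energy_norm A u); apply: le_trans g_a.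
have a00 : a 0%N = 0.
  apply/eqP; rewrite eq_le; have := a0 y yA; rewrite uy0 normr0 => -> /=.
  by have [z zA ->] := aval 0%N A0; exact: normr_ge0.
have Ak' : (#|A|.-1 <= k)%N by rewrite -ltnS prednK.
rewrite -{1}(prednK A0) big_nat_recl //= a00 expr0n add0r.
exact: path_bound_le c0 Ak' kc _ a00.
Qed.

(** Two edges to zeros, at different vertices, support one vertex more than a single edge. They pay
    for the two smallest values of |u|: the smallest one bears its own mass since [c <= 1], and the
    second starts a path with at most [k] edges. *)
Lemma tree_two_zero_bound r A u y z k (c : R) : rooted_tree r A ->
  y \in A -> z \in A -> y != z -> 0 <= c <= 1 -> path_bound k c ->
  (#|A| <= k.+1)%N -> c * mass A u <= energy A u + u y ^+ 2 + u z ^+ 2.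
Proof.
move=> rA yA zA yz /andP[c0 c1] kc Ak; have A0 := rooted_tree_gt0 rA.
have [a [a0 a1 aval m_a g_a]] := sorted_profile (fun x => `|u x|) rA.
rewrite mass_norm in m_a; rewrite m_a.
have A1 : (1 < #|A|)%N.
  by apply/card_gt1P; exists y, z.
have [n An] : exists n, #|A| = n.+2 by exists (#|A|.-2);
  rewrite -subn2 -addn2 subnK.
rewrite An /= !ltnS in m_a g_a Ak *.
have H : c * \sum_(0 <= j < n.+1) a j.+1 ^+ 2 <=
    a 1%N ^+ 2 + \sum_(0 <= j < n) (a j.+2 - a j.+1) ^+ 2.
  have := path_bound_le c0 Ak kc (a :=
    fun j => if j is j'.+1 then a j'.+1 else 0) erefl.
  by rewrite [X in _ <= X]big_nat_recl //= subr0.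
have {}g_a := le_trans g_a (energy_norm A u).
rewrite big_nat_recl //= in g_a; rewrite big_nat_recl //=.
have [z0 z0A a00] := aval 0%N A0; have [z1 z1A a11] := aval 1%N A1.
have a0_ge0 : 0 <= a 0%N by rewrite a00.
have a1_ge0 : 0 <= a 1%N by rewrite a11.
have y0 := a0 y yA; have z0' := a0 z zA.
have nsq x : u x ^+ 2 = `|u x| ^+ 2 by rewrite real_normK ?num_real.
have yz2 : a 0%N ^+ 2 + a 1%N ^+ 2 <= u y ^+ 2 + u z ^+ 2.
  rewrite !nsq; case: (a1 y z yA zA yz) => h;
    last by rewrite lerD // ler_sqr ?nnegrE.
  by rewrite [leLHS]addrC lerD // ler_sqr ?nnegrE.
have quad : c * a 0%N ^+ 2 + a 1%N ^+ 2 <=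
    (a 1%N - a 0%N) ^+ 2 + a 0%N ^+ 2 + a 1%N ^+ 2.
  rewrite lerD2r; apply: le_trans (_ : a 0%N ^+ 2 <= _);
    last by rewrite lerDr sqr_ge0.
  by rewrite ler_piMl ?sqr_ge0.
by rewrite mulrDr; lra.
Qed.

(** * Cutting a tree into pieces that are controlled by one zero each *)

Definition vanishes_on S u := {in S, forall s, u s = 0}.

(** A piece to be cut off: it costs one zero, at its root [v], and takes at least [k.+1] vertices
    away. *)
Definition heavy_tree k (c : R) v D :=
  [/\ rooted_tree v D, (k < #|D|)%N &
      forall u, u v = 0 -> c * mass D u <= energy D u].

Section Cuts.
Variables (k : nat) (c : R).
Hypotheses (c_ge0 : 0 <= c) (kc : path_bound k c).

(** Induction on the graftings. If the hung subtree [D] has more than [k] vertices, a heavy tree is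
    found in it, possibly all of [D]. Otherwise [D] is controlled by its edge to a zero at [r], and
    the search goes on in [A]; if nothing can be peeled there, the whole tree is heavy. *)
Lemma peel_heavy_tree r A : rooted_tree r A -> (k < #|A|)%N ->
  heavy_tree k c r A \/
  exists A' D v a, [/\ rooted_tree r A', a \in A', e a v, heavy_tree k c v D &
                      [disjoint A' & D] /\ A = A' :|: D].
Proof.
elim=> {r A} [r|r x A D rA IHA xD IHD dAD erx] ltk.
  left; split=> // [|u ur0]; first exact: RootedSingle.
  by rewrite mass1 ur0 expr0n mulr0 energy_ge0.
have r0 := rooted_tree_root rA; have x0 := rooted_tree_root xD.
have [ltD|leD] := ltnP k #|D|.
  right; case: (IHD ltD) => [hD|[D' [D'' [v [a [xD' aD' eav hD [dD DE]]]]]]].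
    by exists A, D, x, r; split.
  have [dA' dA''] : [disjoint A & D'] /\ [disjoint A & D''].
    by split; apply: disjointWr dAD; rewrite DE ?subsetUl ?subsetUr.
  exists (A :|: D'), D'', v, a; split=> //.
  - exact: RootedGraft rA xD' dA' erx.
  - by rewrite inE aD' orbT.
  split; last by rewrite DE setUA.
  rewrite -setI_eq0 setIUl setU_eq0 !setI_eq0; exact/andP.
have D_bound u : u r = 0 -> c * mass D u <= energy D u + (u r - u x) ^+ 2.
  by move=> ->; rewrite sub0r sqrrN; apply: tree_path_bound xD x0 c_ge0 kc leD.
have gAD := RootedGraft rA xD dAD erx.
have heavy : (forall u, u r = 0 -> c * mass A u <= energy A u) ->
    heavy_tree k c r (A :|: D).
  move=> hA; split=> // u ur0; have := energyU_edge u dAD r0 x0 erx.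
  by rewrite massU // mulrDr; have := hA u ur0; have := D_bound u ur0; lra.
have [ltA|leA] := ltnP k #|A|; last first.
  by left; apply: heavy => u ur0;
    apply: (tree_zero_bound rA r0 c_ge0 kc (leqW leA)).
case: (IHA ltA) => [[_ _ hA]|[A' [A'' [v [a [rA' aA' eav hA [dA AE]]]]]]].
  by left; exact: heavy.
have [dA' dA''] : [disjoint A' & D] /\ [disjoint A'' & D].
  by split; apply: disjointWl dAD; rewrite AE ?subsetUl ?subsetUr.
right; exists (A' :|: D), A'', v, a; split=> //.
- exact: RootedGraft rA' xD dA' erx.
- by rewrite inE aA'.
split; last by rewrite AE setUAC.
by rewrite -setI_eq0 setIUl setU_eq0 !setI_eq0 dA disjoint_sym.
Qed.

(** Since [u v = 0], the edge from [a] to [v] supplies the term [u a ^+ 2] that the rest of the tree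
    needs. *)
Lemma heavy_tree_join A D v a u : [disjoint A & D] -> a \in A -> e a v ->
  heavy_tree k c v D -> u v = 0 ->
  c * mass A u <= energy A u + u a ^+ 2 ->
  c * mass (A :|: D) u <= energy (A :|: D) u.
Proof.
move=> dAD aA eav [vD _ hD] uv0 hA.
have := energyU_edge u dAD aA (rooted_tree_root vD) eav.
by rewrite uv0 subr0 massU // mulrDr; have := hD u uv0; lra.
Qed.

Lemma vanishes_on1 v u : vanishes_on [set v] u -> u v = 0.
Proof. by apply; rewrite inE. Qed.

Lemma vanishes_onU1 v S u : vanishes_on (v |: S) u ->
  u v = 0 /\ vanishes_on S u.
Proof. by move=> h; split=> [|s sS]; apply: h;
  rewrite !inE ?eqxx // sS orbT. Qed.

(** Each heavy tree cut off takes at least [k.+1] vertices and costs one zero, which in turn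
    supports the remainder. A remainder of at most [k] vertices needs no zero of its own. *)
Lemma cut_attached_tree i r A a : rooted_tree r A -> a \in A ->
  (#|A| < k.+1 * i)%N ->
  exists2 S : {set V}, (#|S| < i)%N &
    forall u, vanishes_on S u -> c * mass A u <= energy A u + u a ^+ 2.
Proof.
elim: i r A a => [|i IHi] r A a rA aA; first by rewrite muln0.
move=> ltA; have [leA|gtA] := leqP #|A| k.
  exists set0; first by rewrite cards0.
  by move=> u _; apply: tree_path_bound rA aA c_ge0 kc leA.
have := peel_heavy_tree rA gtA.
case=> [[_ _ hA]|[A' [D [v [b [rA' bA' ebv hD [dA AE]]]]]]].
  exists [set r].
    by rewrite cards1 ltnS lt0n; apply: contraTneq ltA => ->;
      rewrite muln1 -leqNgt.
  move=> u /vanishes_on1 ur0; rewrite -[leLHS]addr0 lerD ?sqr_ge0 //.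
  exact: hA.
have ltA' : (#|A'| < k.+1 * i)%N.
  have [_ kD _] := hD; move: ltA; rewrite AE cardsU disjoint_setI0 // cards0.
  by rewrite mulnS; lia.
have [S ltS hS] := IHi _ _ _ rA' bA' ltA'; exists (v |: S).
  by rewrite cardsU1; case: (v \in S) => /=; lia.
move=> u /vanishes_onU1[uv0 uS]; rewrite -[leLHS]addr0 lerD ?sqr_ge0 // AE.
by apply: heavy_tree_join dA bA' ebv hD uv0 _; exact: hS.
Qed.

(** Nothing supports the whole tree; the first zero comes from the first cut, or is the root if the
    tree is small or already heavy. *)
Lemma cut_tree i r A : rooted_tree r A -> (1 < i)%N -> (#|A| < k.+1 * i)%N ->
  exists2 S : {set V}, (#|S| < i)%N &
    forall u, vanishes_on S u -> c * mass A u <= energy A u.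
Proof.
move=> rA i1 ltA; have [leA|gtA] := leqP #|A| k.
  exists [set r]; first by rewrite cards1.
  move=> u /vanishes_on1.
  exact: (tree_zero_bound rA (rooted_tree_root rA) c_ge0 kc (leqW leA)).
have := peel_heavy_tree rA gtA.
case=> [[_ _ hA]|[A' [D [v [b [rA' bA' ebv hD [dA AE]]]]]]].
  by exists [set r]; [rewrite cards1 | move=> u /vanishes_on1; exact: hA].
have ltA' : (#|A'| < k.+1 * i.-1)%N.
  have [_ kD _] := hD; move: ltA; rewrite AE cardsU disjoint_setI0 // cards0.
  by rewrite -{1}(prednK (ltnW i1)) mulnS; lia.
have [S ltS hS] := cut_attached_tree rA' bA' ltA'; exists (v |: S).
  by rewrite cardsU1; case: (v \in S) => /=; lia.
move=> u /vanishes_onU1[uv0 uS]; rewrite AE.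
by apply: heavy_tree_join dA bA' ebv hD uv0 _; exact: hS.
Qed.

(** * Trees whose number of vertices is a multiple of [k.+1] *)

Variable l : R.
Hypotheses (c_le1 : c <= 1) (l_ge0 : 0 <= l).
Hypothesis lc : forall a : nat -> R,
  c * \sum_(0 <= j < k.+1) a j ^+ 2 <=
  l * a 0%N ^+ 2 + \sum_(0 <= j < k) (a j.+1 - a j) ^+ 2.

(* A splits into trees with k.+1 vertices, rooted at the points of S. *)
Record spine A S : Prop := Spine {
  spine_tree : exists r, rooted_tree r S;
  spine_sub : S \subset A;
  spine_energy : forall u,
    energy S u + c * mass A u <= energy A u + l * mass S u;
  spine_zero : forall u, vanishes_on S u -> c * mass A u <= energy A u }.

(* If one more tree is hung at b outside S, the zero at s can be traded for a
   zero at the root of that tree. *)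
Definition branching A S := {in A, forall b, b \notin S -> exists2 s, s \in S &
  forall u, vanishes_on (S :\ s) u -> c * mass A u <= energy A u + u b ^+ 2}.

(** [D] is hung at a root [a] of the spine, so its root [v] prolongs the tree of roots. The term
    [u a ^+ 2] in the hypothesis on [A] is the energy of the edge to [v] when [u v = 0]. *)
Lemma spine_join A S D v a : spine A S -> a \in S ->
  {in A, forall b, b \notin S -> exists2 s, s \in S &
    forall u, vanishes_on (S :\ s) u ->
      c * mass A u <= energy A u + u a ^+ 2 + u b ^+ 2} ->
  e a v -> heavy_tree k c v D -> #|D| = k.+1 -> [disjoint A & D] ->
  spine (A :|: D) (v |: S) /\ branching (A :|: D) (v |: S).
Proof.
move=> [[r rS] SA En Z] aS br eav hD cD dAD; have [vD _ hD0] := hD.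
have v0 := rooted_tree_root vD; have aA := subsetP SA a aS.
have vA : v \notin A by rewrite (disjointFl dAD).
have vS : v \notin S by apply: contra vA; apply: (subsetP SA).
have Eedge u := energyU_edge u dAD aA v0 eav.
split; first split.
- by exists r; apply: rooted_tree_extend rS aS vS eav.
- by rewrite subUset sub1set !inE v0 orbT subsetU // SA.
- move=> u; have dvS : [disjoint S & [set v]] by rewrite disjoint_sym
  disjoints1.
  have DE : c * mass D u <= energy D u + l * u v ^+ 2.
    by apply: tree_weighted_path_bound vD v0 l_ge0 _; rewrite cD.
  rewrite setUC massU // energyU // massU // energyU // mass1.
  have -> : energy [set v] u = 0.
    by rewrite /energy !big_set1 subrr expr0n mulr0 mul0r.
  (* The edges that [v] adds to the spine are among those between [A] and [D]. *)
  have cross : \sum_(x in S) \sum_(y in [set v]) (e x y)%:R * (u x - u y) ^+ 2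
    <=
      \sum_(x in A) \sum_(y in D) (e x y)%:R * (u x - u y) ^+ 2.
    rewrite [leRHS](big_setID S) /= (setIidPr SA).
    rewrite -[leLHS]addr0 lerD //; last first.
      by apply: sumr_ge0 => x _; apply: sumr_ge0 => y _.
    apply: ler_sum => x _; rewrite big_set1 (bigD1 v) //= lerDl.
    by apply: sumr_ge0 => y _.
  by have := En u; rewrite !mulrDr; lra.
- move=> u /vanishes_onU1[uv0 uS].
  apply: heavy_tree_join dAD aA eav hD uv0 _.
  by rewrite -[leLHS]addr0 lerD ?sqr_ge0 // Z.
move=> b; rewrite inE => bAD; rewrite !inE negb_or => /andP[bv bS].
(* For [b] in [A] the zero at [v] is kept and a root in [S] is traded. For [b] in [D] the zero at
   [v] itself is traded: [D] is then supported at [v], by the zero at [a], and at [b]. *)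
have [bA|bA] := boolP (b \in A).
  have [s sS hs] := br b bA bS; exists s; first by rewrite inE sS orbT.
  move=> u us; have uv0 : u v = 0.
    by apply: us; rewrite !inE eqxx andbT; apply: contraNneq vS => ->.
  have {}us : vanishes_on (S :\ s) u.
    by move=> t; rewrite !inE => /andP[ts tS]; apply: us;
      rewrite !inE ts tS orbT.
  have := hs u us; have := hD0 u uv0; have := Eedge u.
  by rewrite uv0 subr0 massU // mulrDr; lra.
rewrite (negPf bA) /= in bAD; exists v; first by rewrite !inE eqxx.
move=> u; rewrite setU1K // => uS.
have ua0 := uS a aS; have := Z u uS; have := Eedge u.
rewrite ua0 sub0r sqrrN massU // mulrDr.
have := @tree_two_zero_bound v D u v b k c vD v0 bAD.
rewrite eq_sym bv c_ge0 c_le1 cD => /(_ isT isT kc (leqnn _)); lra.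
Qed.

(** The peeled piece has more than [k] vertices. If it has more than [k.+1], the rest is short
    enough to save a zero; if it has exactly [k.+1], the rest is again a multiple, supported at [a],
    and the hypothesis decides. *)
Lemma spine_or_cut_step j :
  (forall r A a, rooted_tree r A -> a \in A -> #|A| = (k.+1 * j.+1)%N ->
    (exists2 S : {set V}, (#|S| <= j)%N & forall u, vanishes_on S u ->
       c * mass A u <= energy A u + u a ^+ 2) \/
    (exists S : {set V}, [/\ #|S| = j.+1, spine A S, a \in S &
       {in A, forall b, b \notin S -> exists2 s, s \in S &
         forall u, vanishes_on (S :\ s) u ->
           c * mass A u <= energy A u + u a ^+ 2 + u b ^+ 2}])) ->
  forall r A, rooted_tree r A -> #|A| = (k.+1 * j.+2)%N ->
    (exists2 S : {set V}, (#|S| < j.+2)%N & forall u, vanishes_on S u ->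
       c * mass A u <= energy A u) \/
    (exists S : {set V}, [/\ #|S| = j.+2, spine A S & branching A S]).
Proof.
move=> IH r A rA cA; have ltkA : (k < #|A|)%N by rewrite cA leq_pmulr.
have := peel_heavy_tree rA ltkA.
case=> [[_ _ hA]|[A' [D [v [a [rA' aA' eav hD [dA AE]]]]]]].
  by left; exists [set r]; [rewrite cards1 | move=> u /vanishes_on1; exact: hA].
have cAE : #|A| = (#|A'| + #|D|)%N by rewrite AE cardsU disjoint_setI0 //
  cards0 subn0.
have cut S : (#|S| <= j)%N -> (forall u, vanishes_on S u ->
      c * mass A' u <= energy A' u + u a ^+ 2) ->
    exists2 S : {set V}, (#|S| < j.+2)%N &
      forall u, vanishes_on S u -> c * mass A u <= energy A u.
  move=> ltS hS; exists (v |: S).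
    by rewrite cardsU1; case: (v \in S) => /=; lia.
  move=> u /vanishes_onU1[uv0 uS]; rewrite AE.
  by apply: heavy_tree_join dA aA' eav hD uv0 _; exact: hS.
have [_ kD _] := hD; rewrite mulnS in cA.
have [cD|neD] := eqVneq #|D| k.+1; last first.
  have ltA' : (#|A'| < k.+1 * j.+1)%N by lia.
  have [S ltS hS] := cut_attached_tree rA' aA' ltA'.
  by left; exact: cut ltS hS.
have cA' : #|A'| = (k.+1 * j.+1)%N by lia.
case: (IH _ _ a rA' aA' cA') => [[S ltS hS]|[S [cS sS aS hS]]].
  by left; exact: cut ltS hS.
right; exists (v |: S); rewrite cardsU1 cS AE.
have vS : v \notin S.
  have [vD _ _] := hD; apply/negP => /(subsetP (spine_sub sS)).
  by rewrite (disjointFl dA) ?(rooted_tree_root vD).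
rewrite vS; have [] := spine_join sS aS hS eav hD cD dA; by split.
Qed.

Lemma spine_or_cut j r A : rooted_tree r A -> #|A| = (k.+1 * j.+2)%N ->
  (exists2 S : {set V}, (#|S| < j.+2)%N & forall u, vanishes_on S u ->
     c * mass A u <= energy A u) \/
  (exists S : {set V}, [/\ #|S| = j.+2, spine A S & branching A S]).
Proof.
elim: j r A => [|j IHj] r0 A0; apply: spine_or_cut_step => r A a rA aA cA.
  (* A single piece of [k.+1] vertices is bounded through any of its vertices, so the vertex [a]
     that supports it is taken as its root. *)
  rewrite muln1 in cA; right; exists [set a]; split; rewrite ?cards1 ?inE //.
    split.
    - exists a; exact: RootedSingle.
    - by rewrite sub1set.
    - move=> u; rewrite /energy !big_set1 subrr expr0n mulr0 mul0r add0r mass1.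
      by apply: tree_weighted_path_bound rA aA l_ge0 _; rewrite cA.
    - move=> u /vanishes_on1; apply: tree_zero_bound rA aA c_ge0 kc _.
      by rewrite cA.
  move=> b bA; rewrite inE => ba; exists a => [|u _]; first by rewrite inE.
  apply: tree_two_zero_bound rA aA bA _ _ kc _; rewrite 1?eq_sym ?c_ge0 //.
  by rewrite cA.
case: (IHj r A rA cA) => [[S ltS hS]|[S [cS sS bS]]].
  left; exists S => // u /hS h; by rewrite -[leLHS]addr0 lerD ?sqr_ge0.
(* If the tree is supported at one of its roots, the spine can grow there; if it is supported
   elsewhere, [branching] saves a zero. *)
have [aS|aS] := boolP (a \in S).
  right; exists S; split=> // b bA bnS; have [s sS' hs] := bS b bA bnS.
  by exists s => // u /hs h; have := sqr_ge0 (u a); lra.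
have [s sS' hs] := bS a aA aS; left; exists (S :\ s) => //.
by have := cardsD1 s S; rewrite sS' cS; lia.
Qed.

End Cuts.

(** * Test functions on the tree of roots *)

Lemma path_energy x p u : uniq (x :: p) -> path e x p ->
  \sum_(0 <= j < size p) (u (nth x (x :: p) j.+1) - u (nth x (x :: p) j)) ^+ 2
    <=
  energy [set z in x :: p] u.
Proof.
elim: p x => [|y p IHp] x; first by rewrite big_nil energy_ge0.
rewrite cons_uniq => /andP[xp up] /= /andP[exy yp].
have -> : [set z in [:: x, y & p]] = [set x] :|: [set z in y :: p].
  by apply/setP => z; rewrite !inE.
have dx : [disjoint [set x] & [set z in y :: p]] by rewrite disjoints1 inE.
apply: le_trans (energyU_edge u dx (set11 x) _ exy); last by rewrite !inE eqxx.
rewrite big_nat_recl //= addrC -[(u x - u y) ^+ 2]sqrrN opprB lerD2r.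
rewrite -[leLHS]add0r lerD ?energy_ge0 //; apply: le_trans (IHp y up yp).
rewrite !big_mkord; rewrite le_eqVlt; apply/orP; left.
apply/eqP/eq_bigr => j _ /=.
by rewrite !(set_nth_default y x) //=; have := ltn_ord j; lia.
Qed.

(** The path is prolonged by an edge that leaves it. If that edge starts at an inner vertex [a], the
    two neighbours of [a] on the path and the new vertex form a claw. *)
Lemma claw_or_path r S n : rooted_tree r S -> (n < #|S|)%N ->
  (exists x (Y : {set V}), [/\ x \in S, Y \subset S, #|Y| = 3%N & {in Y,
    forall y, e x y}]) \/
  (exists x (p : seq V), [/\ size p = n, uniq (x :: p),
    path e x p & {subset x :: p <= S}]).
Proof.
move=> rS; elim: n => [|n IHn] nS.
  right; exists r, [::]; split=> // z; rewrite inE => /eqP ->.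
  exact: rooted_tree_root rS.
case: (IHn (ltnW nS)) => [claw|[x [p [sp up pp pS]]]]; first by left.
have [||a [y [aS yS ap yp eay]]] :=
    rooted_tree_crossing (X := fun z => z \in x :: p) rS.
- by exists x; rewrite ?mem_head // pS ?mem_head.
- have : ~~ (S \subset x :: p).
    apply: contraL nS => /subset_leq_card; rewrite -leqNgt => /leq_trans; apply.
    by apply: leq_trans (card_size _) _; rewrite /= sp.
  by move=> /subsetPn.
have [aE|ax] := eqVneq a x.
  right; exists y, (x :: p); split=> //=; first by rewrite sp.
  - by rewrite yp -cons_uniq.
  - by rewrite e_sym -aE eay aE.
  - by move=> z; rewrite inE => /orP[/eqP->|/pS].
have [aE|al] := eqVneq a (last x p).
  right; exists x, (rcons p y); split.
  - by rewrite size_rcons sp.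
  - by rewrite -rcons_cons rcons_uniq yp.
  - by rewrite rcons_path pp -aE.
  - by move=> z; rewrite -rcons_cons mem_rcons inE => /orP[/eqP->|/pS].
rewrite inE (negPf ax) /= in ap;
  case/splitPr: ap al up pp pS yp {sp} => p1 [|d p2].
  by rewrite last_cat /= eqxx.
move=> _ up pp pS yp; left; pose b := last x p1.
have bm : b \in x :: p1 by exact: mem_last.
have dA : d \in x :: p1 ++ [:: a,
  d & p2] by rewrite -cat_cons mem_cat !inE eqxx !orbT.
have bA : b \in x :: p1 ++ [:: a, d & p2] by rewrite -cat_cons mem_cat bm.
have bd : b != d.
  apply: contraTneq up => bdE; rewrite -cat_cons cat_uniq -bdE /=.
  by rewrite bm !orbT /= andbF.
have by' : b != y by apply: contraNneq yp => <-.
have dy : d != y by apply: contraNneq yp => <-.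
exists a, [set b; d; y]; split=> //.
- by apply/subsetP => z; rewrite !inE => /orP[/orP[]|] /eqP ->;
  rewrite ?(pS _ bA) ?(pS _ dA).
- by rewrite setUC cardsU1 cards2 bd !inE negb_or ![y == _]eq_sym by' dy.
move: pp; rewrite cat_path /= => /and4P[_ eba ead _] z.
by rewrite !inE => /orP[/orP[]|] /eqP ->; rewrite // e_sym.
Qed.

(** On a path through all of [S] the values of [g] are placed in order, and further edges only add
    energy. A claw alone gives a quotient of at least 4, hence at least [l]. *)
Lemma top_test_vector r S (l : R) (g : nat -> R) : irreflexive e ->
  rooted_tree r S -> l <= 4 ->
  (exists2 j, (j < #|S|)%N & g j != 0) ->
  l * \sum_(0 <= j < #|S|) g j ^+ 2 <=
    \sum_(0 <= j < #|S|.-1) (g j.+1 - g j) ^+ 2 ->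
  exists2 w : V -> R, exists2 s, s \in S & w s != 0 &
    l * mass S w <= energy S w.
Proof.
move=> e_irr rS l4 [j0 j0S gj0] gl; have S0 := rooted_tree_gt0 rS.
case: (@claw_or_path r S #|S|.-1 rS); first by rewrite prednK.
  move=> [x [Y [xS YS Y3 exY]]].
  have xY : x \notin Y by apply/negP => /exY; rewrite e_irr.
  (* The eigenvector of the claw for its largest eigenvalue 4: its mass is 12 and the three edges
     have energy 48. *)
  pose w z : R := if z == x then 3 else if z \in Y then -1 else 0.
  exists w; first by exists x; rewrite // /w eqxx pnatr_eq0.
  have wx : w x = 3 by rewrite /w eqxx.
  have wY y : y \in Y -> w y = -1.
    by move=> yY; rewrite /w yY; case: eqP => // yx; rewrite -yx yY in xY.
  have w0 y : y \in S :\ x -> y \notin Y -> w y = 0.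
    by rewrite !inE => /andP[/negPf yx _] /negPf yY; rewrite /w yx yY.
  have YSx : Y \subset S :\ x by rewrite subsetD1 YS.
  have SE : S = [set x] :|: (S :\ x) by rewrite setD1K.
  have dS : [disjoint [set x] & S :\ x] by rewrite disjoints1 !inE eqxx.
  have mE : mass S w = 12.
    rewrite {1}SE massU // mass1 wx /mass (big_setID Y) /= (setIidPr YSx).
    rewrite (eq_bigr (fun=> 1)) => [|y /wY ->]; last by rewrite sqrrN expr1n.
    rewrite sumr_const Y3 big1 => [|y]; first by ring.
    by rewrite inE => /andP[yY yS]; rewrite w0 // expr0n.
  rewrite mE {1}SE energyU // big_set1.
  have : 48 <= \sum_(y in S :\ x) (e x y)%:R * (w x - w y) ^+ 2.
    rewrite (big_setID Y) /= (setIidPr YSx) (eq_bigr (fun=> 16)) => [|y yY].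
      rewrite sumr_const Y3 -[leLHS]addr0 lerD //;
        first by rewrite -mulr_natl; lra.
      by apply: sumr_ge0 => y _.
    by rewrite exY // wx wY // mul1r; ring.
  by have := energy_ge0 [set x] w; have := energy_ge0 (S :\ x) w; lra.
move=> [x [p [sp up pp pS]]].
have sxp : size (x :: p) = #|S| by rewrite /= sp prednK.
have SE : S = [set z in x :: p].
  apply/esym/eqP; rewrite eqEcard; apply/andP; split.
    by apply/subsetP => z; rewrite inE => /pS.
  by rewrite cardsE (card_uniqP up) sxp.
pose w z := g (index z (x :: p)).
have wE j : (j < #|S|)%N -> w (nth x (x :: p) j) = g j.
  by move=> jS; rewrite /w index_uniq // sxp.
exists w.
  by exists (nth x (x :: p) j0); [apply/pS/mem_nth; rewrite sxp | rewrite wE].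
have mE : mass S w = \sum_(0 <= j < #|S|) g j ^+ 2.
  transitivity (\sum_(z <- x :: p) w z ^+ 2).
    by rewrite (big_uniq _ up) /=; apply: eq_bigl => z; rewrite {1}SE inE.
  rewrite (big_nth x) sxp !big_mkord.
  by apply: eq_bigr => j _; rewrite wE.
rewrite mE; apply: le_trans gl _; have := path_energy w up pp; rewrite -SE sp.
rewrite !big_mkord; apply: le_trans; rewrite le_eqVlt; apply/orP; left.
apply/eqP/eq_bigr => j _; have jS : (j.+1 < #|S|)%N by have := ltn_ord j; lia.
by rewrite !wE // ltnW.
Qed.

(** * Lower bounds on subspaces of codimension less than [i] *)

Definition cut_bound (i : nat) (c : R) := exists m (K : V -> 'I_m -> R),
  (m < i)%N /\ forall u, (forall j, \sum_v u v * K v j = 0) ->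
  c * mass setT u <= energy setT u.

Lemma cut_bound_vanishing i c S : (#|S| < i)%N ->
  (forall u, vanishes_on S u -> c * mass setT u <= energy setT u) ->
  cut_bound i c.
Proof.
move=> Si H; exists #|S|, (fun v j => (v == enum_val j)%:R); split=> // u uK.
apply: H => s sS; have := uK (enum_rank_in sS s).
rewrite (bigD1 s) //= enum_rankK_in // eqxx mulr1 big1 ?addr0 // => v vs.
by rewrite (negPf vs) mulr0.
Qed.

Lemma cut_bound_connected (r : V) k c i : connected_graph e -> 0 <= c ->
  path_bound k c -> (1 < i)%N -> (#|V| < k.+1 * i)%N -> cut_bound i c.
Proof.
move=> conn c0 kc i1 ltV; have rV := rooted_tree_setT r conn.
rewrite -cardsT in ltV.
by have [S Si] := cut_tree c0 kc rV i1 ltV; exact: cut_bound_vanishing.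
Qed.

(** Proportionality to [w] on [S] amounts to one linear condition [w s0 * u s = w s * u s0] for each
    point [s] of [S] other than [s0]. *)
Lemma cut_bound_proportional i c S w : (#|S| <= i)%N ->
  (exists2 s, s \in S & w s != 0) ->
  (forall u t, {in S, forall s, u s = t * w s} ->
     c * mass setT u <= energy setT u) ->
  cut_bound i c.
Proof.
move=> Si [s0 s0S ws0] H; pose S' := S :\ s0.
have cS' : (#|S'| < i)%N by have := cardsD1 s0 S; rewrite s0S -/S'; lia.
exists #|S'|, (fun v j => w s0 * (v == enum_val j)%:R - w (enum_val j) * (v ==
  s0)%:R).
split=> // u uK; apply: (H u (u s0 / w s0)) => s sS.
have [->|ss0] := eqVneq s s0; first by rewrite divfK.
have sS' : s \in S' by rewrite !inE ss0.
have := uK (enum_rank_in sS' s); rewrite enum_rankK_in //.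
under eq_bigr do rewrite mulrBr.
rewrite sumrB (bigD1 s) //= [X in _ - X](bigD1 s0) //= !eqxx !mulr1.
rewrite !big1 ?addr0 => [E|v /negPf ->|v /negPf ->]; rewrite ?mulr0 //.
by apply: (mulIf ws0); rewrite mulrAC divfK //; move: E; lra.
Qed.

Lemma cut_bound_divisible (r : V) k c l i (g : nat -> R) :
  irreflexive e -> connected_graph e -> 0 <= c <= 1 -> 0 <= l <= 4 ->
  path_bound k c ->
  (forall a : nat -> R, c * \sum_(0 <= j < k.+1) a j ^+ 2 <=
    l * a 0%N ^+ 2 + \sum_(0 <= j < k) (a j.+1 - a j) ^+ 2) ->
  (exists2 j, (j < i)%N & g j != 0) ->
  l * \sum_(0 <= j < i) g j ^+ 2 <= \sum_(0 <= j < i.-1) (g j.+1 - g j) ^+ 2 ->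
  (1 < i)%N -> #|V| = (k.+1 * i)%N -> cut_bound i c.
Proof.
move=> e_irr conn /andP[c0 c1] /andP[l0 l4] kc lc gi gl i1 cV.
have rV := rooted_tree_setT r conn; rewrite -cardsT in cV.
have [j iE] : exists j, i = j.+2 by exists i.-2; lia.
rewrite iE in cV gi gl *.
have := spine_or_cut c0 kc c1 l0 lc rV cV.
case=> [[S Sj hS]|[S [cS [[rS SrS] _ En _] _]]];
  first exact: cut_bound_vanishing hS.
rewrite -cS in gi gl *.
have [w ws wl] := top_test_vector e_irr SrS l4 gi gl.
apply: (cut_bound_proportional (leqnn _) ws) => u t ut.
have := En u.
have -> : energy S u = t ^+ 2 * energy S w.
  rewrite /energy mulrA; congr (_ / _); rewrite mulr_sumr;
    apply: eq_bigr => x xS.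
  rewrite mulr_sumr; apply: eq_bigr => y yS; rewrite !ut //; ring.
have -> : mass S u = t ^+ 2 * mass S w.
  by rewrite mulr_sumr; apply: eq_bigr => x xS; rewrite ut // exprMn.
have := ler_wpM2l (sqr_ge0 t) wl; lra.
Qed.

End Energy.

(** * Sorted spectra and Rayleigh quotients *)

Section SortedSpectrum.
Variable R : realType.

(** The characteristic polynomial of a symmetric matrix splits, so the choice in [spectrum] does not
    fall back on [[::]]. *)
Lemma spectrumP n (M : 'M[R]_n) : M^T = M ->
  [/\ size (spectrum M) = n, sorted <=%R (spectrum M) &
      char_poly M = \prod_(a <- spectrum M) ('X - a%:P)].
Proof.
move=> /symmetric_spectrum[d [Md _ _]].
have [srt prd] : sorted <=%R (spectrum M) /\
    char_poly M = \prod_(a <- spectrum M) ('X - a%:P).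
  apply: (xgetPex [::] (P := fun s => sorted <=%R s /\
    char_poly M = \prod_(a <- s) ('X - a%:P))).
  exists (sort <=%R [seq d j | j <- enum 'I_n]); split;
    first exact: sort_le_sorted.
  by rewrite (perm_big _ (permEl (perm_sort _ _))) big_map big_enum Md.
split=> //; have := size_char_poly M.
by rewrite prd size_prod_XsubC => -[].
Qed.

(** Entries are counted from 0, so more than [i] eigenvalues are at most the entry of index [i], and
    these outnumber the [m] conditions. *)
Lemma spectrum_minmax n (M : 'M[R]_n) i m (K : 'M[R]_(n, m)) : M^T = M ->
  (m <= i < n)%N ->
  exists x, [/\ x != 0, x *m K = 0 & qform M x <= (spectrum M)`_i * sqnorm x].
Proof.
move=> Msym /andP[mi ltin]; have [szs srt prd] := spectrumP Msym.
have [d [Md _ mm]] := symmetric_spectrum Msym.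
have ds : perm_eq (spectrum M) [seq d j | j <- enum 'I_n].
  apply: prod_XsubC_eq; rewrite -prd Md big_map big_enum; exact: eq_bigr.
pose J := [set j | d j <= (spectrum M)`_i]%SET.
apply: (mm J) => [|j]; last by rewrite inE.
apply: leq_ltn_trans mi _; rewrite ltnNge; apply/negP => leJ.
suff : (spectrum M)`_i < (spectrum M)`_i by rewrite ltxx.
apply: nth_count_gt => //; rewrite szs ltin andbT.
rewrite (permP ds) count_map; apply: leq_trans leJ.
rewrite cardE -size_filter; apply/eq_leq/congr1.
by rewrite /enum_mem -enumT -filter_predI; apply: eq_filter => j /=;
  rewrite !inE andbT.
Qed.

Lemma spectrum_eigenvector n (M : 'M[R]_n) i : M^T = M -> (i < n)%N ->
  exists2 x : 'rV[R]_n, x != 0 & x *m M = (spectrum M)`_i *: x.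
Proof.
move=> Msym ltin; have [szs srt prd] := spectrumP Msym.
have : eigenvalue M (spectrum M)`_i.
  by rewrite eigenvalue_root_char prd root_prod_XsubC mem_nth ?szs.
by move=> /eigenvalueP[x xM xn0]; exists x.
Qed.

Lemma spectrum_bounds n (M : 'M[R]_n) x : M^T = M -> (0 < n)%N ->
  (spectrum M)`_0 * sqnorm x <= qform M x <= (spectrum M)`_n.-1 * sqnorm x.
Proof.
move=> Msym n0; have [szs srt prd] := spectrumP Msym.
have [d [Md ray _]] := symmetric_spectrum Msym.
have ds : perm_eq (spectrum M) [seq d j | j <- enum 'I_n].
  apply: prod_XsubC_eq; rewrite -prd Md big_map big_enum; exact: eq_bigr.
have d_bounds j : (spectrum M)`_0 <= d j <= (spectrum M)`_n.-1.
  have : d j \in spectrum M by rewrite (perm_mem ds) map_f ?mem_enum.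
  move=> /(nthP 0)[a az <-]; rewrite szs in az.
  by apply/andP; split; apply: le_sorted_leq_nth;
    rewrite ?inE ?szs // ?prednK // -ltnS prednK.
have [t t0 [-> ->]] := ray x; rewrite !mulr_sumr; apply/andP.
by split; apply: ler_sum => j _; rewrite ler_wpM2r //; case/andP: (d_bounds j).
Qed.

End SortedSpectrum.

(** * Green's formula on weighted graphs *)

Section WeightedLaplacian.
Variables (R : realType) (T : finType) (w : T -> T -> R).
Hypothesis w_sym : forall x y, w x y = w y x.
Implicit Types u v : T -> R.

(** This is minus the Laplacian for the unit measure; at a boundary vertex the same expression
    defines the Dirichlet-to-Neumann map. *)
Definition net_flow u x := \sum_y (u x - u y) * w x y.

Definition weighted_energy u := (\sum_x \sum_y (u x - u y) ^+ 2 * w x y) / 2.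

Lemma laplacianE u x :
  laplacian (unit_measure R (T := T)) w u x = - net_flow u x.
Proof.
rewrite /laplacian invr1 mul1r -sumrN; apply: eq_bigr => y _.
by rewrite -mulNr opprB.
Qed.

Lemma net_flow_symmetric u v :
  \sum_x v x * net_flow u x = \sum_x u x * net_flow v x.
Proof.
have E (f g : T -> R) : \sum_x f x * net_flow g x =
    \sum_x \sum_y f x * g x * w x y - \sum_x \sum_y f x * g y * w x y.
  rewrite -sumrB; apply: eq_bigr => x _; rewrite mulr_sumr -sumrB.
  by apply: eq_bigr => y _; ring.
rewrite !E; congr (_ - _); last rewrite exchange_big /=;
  apply: eq_bigr => x _; apply: eq_bigr => y _; first by rewrite [v x * _]mulrC.
by rewrite w_sym [v y * _]mulrC.
Qed.

Lemma net_flow_energy u : \sum_x u x * net_flow u x = weighted_energy u.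
Proof.
rewrite (eq_bigr (fun x => \sum_y (u x - u y) * u x * w x y)); last first.
  by move=> x _; rewrite mulr_sumr; apply: eq_bigr => y _; ring.
rewrite /weighted_energy; set S := LHS.
suff -> : \sum_x \sum_y (u x - u y) ^+ 2 * w x y = S + S by field.
have {2}-> : S = \sum_x \sum_y (u y - u x) * u y * w x y.
  rewrite /S exchange_big; apply: eq_bigr => x _; apply: eq_bigr => y _ /=.
  by rewrite w_sym.
rewrite -big_split; apply: eq_bigr => x _ /=.
by rewrite -big_split; apply: eq_bigr => y _ /=; ring.
Qed.

End WeightedLaplacian.

(** * The Dirichlet-to-Neumann matrix and bounds for Steklov eigenvalues *)

Section SteklovProblem.
Variables (R : realType) (V : finType) (e : rel V) (B : {set V}).
Hypotheses (e_sym : symmetric e) (conn : connected_graph e).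
Hypothesis B_graph : graph_boundary e B.
Implicit Types u : V -> R.

Let w_sym x y : unit_weight R e x y = unit_weight R e y x.
Proof. by rewrite /unit_weight e_sym. Qed.

Local Notation outflow := (net_flow (unit_weight R e)).

Lemma outflow_energy u : \sum_x u x * outflow u x = energy e finset.setT u.
Proof.
rewrite net_flow_energy //; congr (_ / _).
apply: eq_big => [x|x _]; first by rewrite inE.
by apply: eq_big => [y|y _]; [rewrite inE | rewrite mulrC].
Qed.

Lemma energy0_constant u : energy e finset.setT u = 0 -> forall x y, u x = u y.
Proof.
move=> E0 x y; have edge a b : e a b -> u a = u b.
  move=> eab; have : energy e finset.setT u == 0 by rewrite E0.
  rewrite /energy mulf_eq0 invr_eq0 pnatr_eq0 orbF psumr_eq0; last first.
    by move=> z _; apply: sumr_ge0 => t _; rewrite mulr_ge0 ?sqr_ge0.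
  move=> /allP/(_ a); rewrite mem_index_enum inE => /(_ isT).
  rewrite /= psumr_eq0; last by move=> z _; rewrite mulr_ge0 ?sqr_ge0.
  move=> /allP/(_ b); rewrite mem_index_enum inE => /(_ isT) /=.
  by rewrite eab mul1r sqrf_eq0 subr_eq0 => /eqP.
have /connectP[p pP ->] := conn x y; elim: p x pP => [//|z p IHp] x /=.
by move=> /andP[/edge -> /IHp].
Qed.

Lemma mass_eq0 (A : {set V}) u : mass A u = 0 -> {in A, forall x, u x = 0}.
Proof.
move=> /eqP; rewrite psumr_eq0 => [|x _]; last exact: sqr_ge0.
move=> /allP h x xA; have := h x; rewrite mem_index_enum xA => /(_ isT) /=.
by rewrite sqrf_eq0 => /eqP.
Qed.

(** By Green's formula the energy is zero, so [u] is constant, and it vanishes on the nonempty set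
    [B]. *)
Lemma harmonic_unique u : (forall x, x \in B -> u x = 0) ->
  (forall x, x \notin B -> outflow u x = 0) -> forall x, u x = 0.
Proof.
move=> uB uI x; have [B0 _ _] := B_graph; have /set0Pn[b bB] := B0.
rewrite -(uB b bB); apply: energy0_constant;
  rewrite -outflow_energy big1 // => y _.
by have [/uB ->|/uI ->] := boolP (y \in B); rewrite ?mul0r ?mulr0.
Qed.

(** A square matrix with zero kernel is invertible; this turns uniqueness of harmonic extensions
    into existence. *)
Lemma injective_linear_surjective (t : V -> V -> R) :
  (forall u, (forall x, \sum_y u y * t y x = 0) -> forall x, u x = 0) ->
  forall g : V -> R, exists u, forall x, \sum_y u y * t y x = g x.
Proof.
move=> inj g; pose M : 'M[R]_#|V| := \matrix_(a, b) t (enum_val a) (enum_val b).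
have act (r : 'rV[R]_#|V|) b : (r *m M) 0 b =
    \sum_y r 0 (enum_rank y) * t y (enum_val b).
  rewrite mxE (reindex (@enum_rank V)) /=; last first.
    by exists enum_val => z _; rewrite ?enum_valK ?enum_rankK.
  by apply: eq_bigr => y _; rewrite mxE enum_rankK.
have Mu : M \in unitmx.
  rewrite -row_free_unit -kermx_eq0; apply/eqP/row_matrixP => c.
  rewrite row0; apply/rowP => b; rewrite [RHS]mxE.
  have kM : row c (kermx M) *m M = 0 by rewrite -row_mul mulmx_ker row0.
  have := inj (fun y => row c (kermx M) 0 (enum_rank y)).
  move=> /(_ _ (enum_val b)); rewrite enum_valK; apply => x.
  by have := act (row c (kermx M)) (enum_rank x); rewrite kM enum_rankK mxE.
pose r := (\row_b g (enum_val b)) *m invmx M.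
exists (fun y => r 0 (enum_rank y)) => x.
by have := act r (enum_rank x); rewrite mulmxKV // mxE !enum_rankK.
Qed.

Lemma harmonic_exists (g : V -> R) : exists u, (forall x,
  x \in B -> u x = g x) /\
  (forall x, x \notin B -> outflow u x = 0).
Proof.
(* The linear system reads [u x] at boundary vertices and [outflow u x] at interior ones. *)
pose t y x : R := if x \in B then (y == x)%:R else
  (y == x)%:R * (\sum_z (e x z)%:R) - (e x y)%:R.
have tE u x : \sum_y u y * t y x = if x \in B then u x else outflow u x.
  rewrite /t; case: (x \in B).
    rewrite (bigD1 x) //= eqxx mulr1 big1 ?addr0 // => y /negPf ->.
    by rewrite mulr0.
  rewrite /net_flow /unit_weight; under [RHS]eq_bigr do rewrite mulrBl.
  rewrite sumrB -mulr_sumr; under eq_bigr do rewrite mulrBr.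
  rewrite sumrB; congr (_ - _); set d := \sum_z _.
  rewrite (bigD1 x) //= eqxx mul1r [X in _ + X]big1 ?addr0 //.
  by move=> y /negPf ->; rewrite mul0r mulr0.
have [|u uE] := injective_linear_surjective (t :=
  t) _ (fun x => if x \in B then g x else 0).
  move=> u u0; apply: harmonic_unique => x xB; have := u0 x; rewrite tE.
    by rewrite xB.
  by rewrite (negPf xB).
exists u; split=> x xB; have := uE x; rewrite tE; first by rewrite xB.
by rewrite (negPf xB).
Qed.

Local Notation bd := {x | x \in B}.
Local Notation H := (harmonic_extension (unit_measure R (T :=
  V)) (unit_weight R e)
  (B := B)).

Lemma harmonic_extensionP (f : bd -> R) : (forall b, H f (val b) = f b) /\
  (forall x, x \notin B -> outflow (H f) x = 0).
Proof.
have : exists u : V -> R, mkset (fun u : V -> R => (forall b : bd,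
  u (val b) = f b) /\
    forall x, x \notin B ->
      laplacian (unit_measure R (T := V)) (unit_weight R e) u x = 0) u.
  have [u [uB uI]] := harmonic_exists (fun x =>
    if insub x is Some b then f b else 0).
  exists u; split=> [b|x xB]; first by rewrite uB ?(valP b) // valK.
  by rewrite laplacianE uI ?oppr0.
move=> /xgetPex - /(_ (fun=> 0)) [HB HI]; split=> // x /HI.
by rewrite laplacianE => /eqP; rewrite oppr_eq0 => /eqP.
Qed.

Local Notation N := #|{: bd}|.

Definition extend (x : 'rV[R]_N) : V -> R := H (fun b => x 0 (enum_rank b)).

Let basis (a : 'I_N) : V -> R := H (fun b => (b == enum_val a)%:R).

Let basis_val a (b : bd) : basis a (val b) = (b == enum_val a)%:R.
Proof. exact: (harmonic_extensionP _).1. Qed.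

(** Linearity of the harmonic extension, a consequence of uniqueness. *)
Lemma extendE x v : extend x v = \sum_a x 0 a * basis a v.
Proof.
pose u z := extend x z - \sum_a x 0 a * basis a z.
suff : u v = 0 by move/eqP; rewrite subr_eq0 => /eqP.
have [xB xI] := harmonic_extensionP (fun b => x 0 (enum_rank b)).
apply: harmonic_unique => z zB.
  pose b : bd := exist (fun z => z \in B) z zB.
  rewrite /u /extend -[z]/(val b) xB (bigD1 (enum_rank b)) //= big1.
    by rewrite [basis _ z](basis_val _ b) enum_rankK eqxx mulr1 addr0 subrr.
  move=> a ab; rewrite [basis _ z](basis_val _ b) -(inj_eq enum_rank_inj)
    enum_valK eq_sym.
  by rewrite (negPf ab) mulr0.
have -> : outflow u z = outflow (extend x) z - \sum_a x 0 a * outflow (basis a)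
  z.
  have -> : \sum_a x 0 a * outflow (basis a) z =
      outflow (fun t => \sum_a x 0 a * basis a t) z.
    under eq_bigr do rewrite mulr_sumr.
    rewrite exchange_big; apply: eq_bigr => y _ /=.
    by rewrite -sumrB mulr_suml; apply: eq_bigr => a _; ring.
  by rewrite -sumrB; apply: eq_bigr => y _; rewrite /u; ring.
rewrite xI // big1 ?subr0 // => a _.
by rewrite (harmonic_extensionP _).2 ?mulr0.
Qed.

Local Notation M := (operator_mx (dirichlet_to_neumann (unit_measure R (T := V))
  (unit_weight R e) (B := B))).

Let M_E a b : M a b = outflow (basis b) (val (enum_val a)).
Proof. by rewrite mxE. Qed.

Let sum_boundary (F : V -> R) :
  \sum_(a < N) F (val (enum_val a)) = \sum_(x in B) F x.
Proof.
rewrite (big_sub (mem B)) /= [RHS](reindex (@enum_val _ (mem {: bd}))) //=.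
exists enum_rank => a _; [exact: enum_valK | exact: enum_rankK].
Qed.

(** On [B] the function [basis a] is the indicator of one vertex, and off [B] the outflow of
    [basis b] vanishes. In this form the symmetry of [M] is Green's formula. *)
Let M_form a b : M a b = \sum_x basis a x * outflow (basis b) x.
Proof.
rewrite (bigID (mem B)) /= [X in _ + X]big1 => [|x xB]; last first.
  by rewrite (harmonic_extensionP _).2 ?mulr0.
rewrite addr0 -(sum_boundary (fun x => basis a x * outflow (basis b) x)).
rewrite (bigD1 a) //= big1 => [|c ca].
  by rewrite addr0 M_E basis_val eqxx mul1r.
by rewrite basis_val (inj_eq enum_val_inj) (negPf ca) mul0r.
Qed.

Lemma dtn_symmetric : M^T = M.
Proof. by apply/matrixP => a b; rewrite mxE !M_form net_flow_symmetric. Qed.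

Lemma dtn_mul x a : (x *m M) 0 a = outflow (extend x) (val (enum_val a)).
Proof.
rewrite -dtn_symmetric mxE /net_flow /unit_weight.
under eq_bigr do rewrite mxE M_E /net_flow /unit_weight mulr_sumr.
rewrite exchange_big; apply: eq_bigr => y _ /=.
rewrite !extendE -sumrB mulr_suml; apply: eq_bigr => c _; ring.
Qed.

Lemma extend_boundary x a : extend x (val (enum_val a)) = x 0 a.
Proof. by rewrite /extend (harmonic_extensionP _).1 enum_valK. Qed.

Lemma extend_harmonic x v : v \notin B -> outflow (extend x) v = 0.
Proof. exact: (harmonic_extensionP _).2. Qed.

Lemma dtn_qform x : qform M x = energy e finset.setT (extend x).
Proof.
rewrite -outflow_energy (bigID (mem B)) /= [X in _ + X]big1 => [|v vB];
  last first.
  by rewrite extend_harmonic ?mulr0.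
rewrite addr0 -(sum_boundary (fun v => extend x v * outflow (extend x) v)).
rewrite /qform mxE; apply: eq_bigr => a _.
by rewrite dtn_mul mxE extend_boundary mulrC.
Qed.

Lemma dtn_sqnorm x : sqnorm x = mass B (extend x).
Proof.
rewrite /mass -(sum_boundary (fun v => extend x v ^+ 2)).
by apply: eq_bigr => a _; rewrite extend_boundary.
Qed.

Lemma card_boundary : N = #|B|.
Proof. by rewrite card_sig. Qed.

Local Notation sigma := (steklov_eigenvalue (unit_measure R (T := V))
  (unit_weight R e) B).

(** The conditions [K] on functions on [V] are pulled back to boundary functions by harmonic
    extension. There are at most [i.-1] of them, and [i.-1] is the index of [sigma i] in the
    list. *)
Lemma steklov_test_function i c : (0 < i <= #|B|)%N -> cut_bound e i c ->
  exists u, [/\ 0 < mass B u, energy e finset.setT u <= sigma i * mass B u &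
    c * mass finset.setT u <= energy e finset.setT u].
Proof.
move=> /andP[i0 iB] [m [K [mi cK]]].
pose L : 'M[R]_(N, m) := \matrix_(a, j) \sum_v basis a v * K v j.
have iN : (m <= i.-1 < N)%N by rewrite card_boundary; lia.
have [x [xn0 xL xs]] := spectrum_minmax L dtn_symmetric iN.
exists (extend x); split.
- by rewrite -dtn_sqnorm lt0r sqnorm_eq0 xn0 sqnorm_ge0.
- by rewrite -dtn_sqnorm -dtn_qform.
apply: cK => j; have := congr1 (fun v : 'rV_m => v 0 j) xL; rewrite !mxE => xLj.
rewrite -[RHS]xLj; under eq_bigr do rewrite extendE mulr_suml.
rewrite exchange_big; apply: eq_bigr => a _ /=; rewrite mxE mulr_sumr.
by apply: eq_bigr => v _; rewrite mulrA.
Qed.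

Lemma mass_boundary u :
  mass finset.setT u = mass B u + mass (finset.setC B) u.
Proof.
have dB : [disjoint B & finset.setC B] by rewrite -finset.setI_eq0
  finset.setICr.
by rewrite -massU // finset.setUCr.
Qed.

Lemma steklov_ge i c : (0 < i <= #|B|)%N -> 0 <= c -> cut_bound e i c ->
  c <= sigma i.
Proof.
move=> iB c0 /(steklov_test_function iB)[u [uB us uc]].
rewrite -(ler_pM2r uB); apply: le_trans us; apply: le_trans uc.
by rewrite ler_wpM2l // mass_boundary lerDl mass_ge0.
Qed.

Lemma steklov_gt i c : (0 < i <= #|B|)%N -> 0 < c < 1 -> cut_bound e i c ->
  c < sigma i.
Proof.
move=> iB /andP[c0 c1] /(steklov_test_function iB)[u [uB us uc]].
rewrite ltNge; apply/negP => sc; rewrite mass_boundary in uc.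
(* If [sigma i <= c], then [c] times the interior mass is at most 0, and [0 < c] leaves no mass in
   the interior. *)
have uI : mass (finset.setC B) u = 0.
  have := mass_ge0 (finset.setC B) u.
  have : sigma i * mass B u <= c * mass B u by rewrite (ler_wpM2r (ltW uB) sc).
  rewrite mulrDr in uc => h m0; apply/eqP; rewrite eq_le m0 andbT.
  by rewrite -(ler_pM2l c0) mulr0; lra.
have u0 v : v \notin B -> u v = 0 by move=> vB; apply: (mass_eq0 uI);
  rewrite inE.
(* Each boundary vertex has an interior neighbour, where [u] vanishes; the edge to it has energy
   [u x ^+ 2]. *)
have : mass B u <= energy e finset.setT u.
  have [_ _ Badj] := B_graph.
  have dB : [disjoint B & finset.setC B] by rewrite -finset.setI_eq0
    finset.setICr.
  rewrite -(finset.setUCr B) energyU // -[leLHS]add0r lerD //.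
    by rewrite addr_ge0 ?energy_ge0.
  apply: ler_sum => x xB; have [y yB exy] := Badj x xB.
  rewrite (bigD1 y) ?inE //= exy mul1r (u0 y yB) subr0 lerDl.
  by apply: sumr_ge0 => z _; rewrite mulr_ge0 ?sqr_ge0.
have : c * mass B u < mass B u by rewrite -[ltRHS]mul1r (ltr_pM2r uB).
have : sigma i * mass B u <= c * mass B u by rewrite (ler_wpM2r (ltW uB) sc).
lra.
Qed.

(** The value at the center is the mean of the boundary values, so the energy is the boundary mass
    minus [#|B|] times [u o ^+ 2]. *)
Lemma steklov_star_le1 i n : (0 < i <= #|B|)%N ->
  star_with_boundary e B n -> sigma i <= 1.
Proof.
move=> /andP[i0 iB] [ o [_ oE BE]].
have iN : (i.-1 < N)%N by rewrite card_boundary; lia.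
have [x xn0 xM] := spectrum_eigenvector dtn_symmetric iN.
have x0 : 0 < sqnorm x by rewrite lt0r sqnorm_eq0 xn0 sqnorm_ge0.
rewrite -(ler_pM2r x0) mul1r.
have -> : (spectrum M)`_i.-1 * sqnorm x = qform M x.
  rewrite /qform xM mxE mulr_sumr; apply: eq_bigr => a _; rewrite !mxE; ring.
set u := extend x.
have ob : outflow u o = 0 by apply: extend_harmonic; rewrite BE !inE eqxx.
have inB b : (b \in B) = (b != o) by rewrite BE !inE.
have outB b : b \in B -> outflow u b = u b - u o.
  rewrite inB => bo; rewrite /net_flow /unit_weight (bigD1 o) //=
    oE (negPf bo) eqxx /= mulr1.
  rewrite big1 ?addr0 // => y yo; rewrite oE (negPf bo) (negPf yo);
    exact: mulr0.
have uo : #|B|%:R * u o = \sum_(b in B) u b.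
  move: ob; rewrite /net_flow /unit_weight (bigD1 o) //= subrr mul0r add0r.
  rewrite (eq_bigr (fun b => u o - u b)) => [|b bo]; last first.
    by rewrite oE eqxx (negPf bo) mulr1.
  rewrite sumrB => /eqP; rewrite subr_eq0 => /eqP.
  rewrite !(eq_bigl _ _ (fun b => esym (inB b))) => <-.
  by rewrite sumr_const mulr_natl.
rewrite dtn_qform dtn_sqnorm -outflow_energy (bigID (mem B)) /=.
rewrite [X in _ + X]big1 => [|v vB]; last by rewrite extend_harmonic ?mulr0.
rewrite addr0 -/u (eq_bigr (fun b => u b ^+ 2 - u o * u b)) => [|b /outB ->];
  last ring.
rewrite sumrB -mulr_sumr -uo lerBlDr lerDl mulrCA -expr2.
by rewrite mulr_ge0 ?sqr_ge0.
Qed.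

End SteklovProblem.

(** * Extreme Dirichlet eigenvalues of weighted graphs *)

Section WeightedGraphs.
Variables (R : realType) (T : finType) (w : T -> T -> R) (B : {set T}).
Hypothesis w_sym : forall x y, w x y = w y x.
Implicit Types u : T -> R.

Lemma dirichlet_eigenfunction_energy mu :
  dirichlet_eigenvalues (unit_measure R (T := T)) w B mu ->
  exists u, [/\ exists x, u x != 0, forall x, x \in B -> u x = 0 &
    weighted_energy w u = mu * \sum_x u x ^+ 2].
Proof.
move=> [u [un0 uB uE]]; exists u; split=> //.
rewrite -net_flow_energy // mulr_sumr; apply: eq_bigr => x _.
have [/uB ->|/uE] := boolP (x \in B); first by rewrite mul0r expr0n mulr0.
by rewrite laplacianE opprK => ->; ring.
Qed.

Local Notation I := (finset.setC B).
(** Minus the Laplacian on the interior, for functions extended by zero; the diagonal also counts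
    the edges to [B]. *)
Let M : 'M[R]_#|I| := \matrix_(a, b)
  ((a == b)%:R * (\sum_y w (enum_val a) y) - w (enum_val a) (enum_val b)).

Let M_sym : M^T = M.
Proof.
apply/matrixP => a b; rewrite !mxE [b == a]eq_sym w_sym.
by case: eqP => [->|_]; rewrite ?mul0r.
Qed.

Let ext (x : 'rV[R]_#|I|) v : R := \sum_a x 0 a * (v == enum_val a)%:R.

Let ext_val x a : ext x (enum_val a) = x 0 a.
Proof.
rewrite /ext (bigD1 a) //= eqxx mulr1 big1 ?addr0 // => b ba.
by rewrite (inj_eq enum_val_inj) eq_sym (negPf ba) mulr0.
Qed.

Let ext_boundary x v : v \in B -> ext x v = 0.
Proof.
move=> vB; rewrite /ext big1 // => a _; case: eqP => [va|];
  last by rewrite mulr0.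
by have := enum_valP a; rewrite -va !inE vB.
Qed.

Let interior_sum (F : T -> R) : (forall v, v \in B -> F v = 0) ->
  \sum_v F v = \sum_a F (enum_val (A := mem I) a).
Proof.
move=> FB; rewrite -big_enum_val [RHS]big_mkcond /=; apply: eq_bigr => v _.
by rewrite !inE; case: ifPn => // /negPn /FB.
Qed.

Let mulM x a : (x *m M) 0 a = net_flow w (ext x) (enum_val a).
Proof.
rewrite -M_sym mxE.
under eq_bigr do rewrite !mxE mulrBr.
rewrite sumrB (bigD1 a) //= eqxx mul1r [X in _ + X - _]big1 ?addr0 => [|b ba].
  rewrite /net_flow; under [RHS]eq_bigr do rewrite mulrBl.
  rewrite sumrB -mulr_sumr ext_val; congr (_ - _).
  rewrite (interior_sum (F := fun y => ext x y * w (enum_val a) y)) => [|v vB].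
    by apply: eq_bigr => b _; rewrite ext_val.
  by rewrite ext_boundary // mul0r.
by rewrite eq_sym (negPf ba) mul0r mulr0.
Qed.

Let qformM x : qform M x = weighted_energy w (ext x).
Proof.
rewrite -net_flow_energy //.
rewrite interior_sum => [|v vB]; last by rewrite ext_boundary ?mul0r.
by rewrite /qform mxE; apply: eq_bigr => a _; rewrite mulM mxE ext_val mulrC.
Qed.

Let sqnormE x : sqnorm x = \sum_v ext x v ^+ 2.
Proof.
rewrite interior_sum => [|v vB]; last by rewrite ext_boundary ?expr0n.
by apply: eq_bigr => a _; rewrite ext_val.
Qed.

Let extK u : (forall v, v \in B -> u v = 0) ->
  ext (\row_a u (enum_val a)) =1 u.
Proof.
move=> uB v; have [vB|vB] := boolP (v \in B); first by rewrite ext_boundary ?uB.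
have vI : v \in I by rewrite inE.
by rewrite -(enum_rankK_in vI vI) ext_val mxE.
Qed.

Let spectrum_eigenvalue j : (j < #|I|)%N ->
  dirichlet_eigenvalues (unit_measure R (T := T)) w B (spectrum M)`_j.
Proof.
move=> jI; have [x xn0 xM] := spectrum_eigenvector M_sym jI.
exists (ext x); split; last 1 first.
- move=> v vB; rewrite laplacianE opprK; have vI : v \in I by rewrite inE.
  by rewrite -(enum_rankK_in vI vI) -mulM xM mxE ext_val.
- move/rV0Pn: xn0 => [a xa]; exists (enum_val a); by rewrite ext_val.
- by move=> v; exact: ext_boundary.
Qed.

Let rayleigh u : I != finset.set0 -> (forall v, v \in B -> u v = 0) ->
  (spectrum M)`_0 * \sum_v u v ^+ 2 <= weighted_energy w u <=
  (spectrum M)`_#|I|.-1 * \sum_v u v ^+ 2.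
Proof.
rewrite -card_gt0 => I0 uB.
have := spectrum_bounds (\row_a u (enum_val a)) M_sym I0.
have extE := funext (extK uB); by rewrite sqnormE qformM extE.
Qed.

Let eigenvalue_bounds mu : I != finset.set0 ->
  dirichlet_eigenvalues (unit_measure R (T := T)) w B mu ->
  (spectrum M)`_0 <= mu <= (spectrum M)`_#|I|.-1.
Proof.
move=> I0 /dirichlet_eigenfunction_energy[u [[x ux] uB uE]].
have := rayleigh I0 uB; rewrite uE.
have u2 : 0 < \sum_v u v ^+ 2.
  rewrite (bigD1 x) //= ltr_wpDr ?sumr_ge0 // => [v _|]; first exact: sqr_ge0.
  by rewrite lt0r sqrf_eq0 ux sqr_ge0.
by rewrite !ler_pM2r.
Qed.

(** The first entry of the spectrum of [M] is a least eigenvalue, so [smallest] does not take its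
    default value. *)
Lemma smallest_dirichlet_eigenvalue : I != finset.set0 ->
  dirichlet_eigenvalues (unit_measure R (T := T)) w B
    (Defs.smallest (dirichlet_eigenvalues (unit_measure R (T := T)) w B)) /\
  forall u, (forall v, v \in B -> u v = 0) ->
    Defs.smallest (dirichlet_eigenvalues (unit_measure R (T := T)) w B) *
      \sum_v u v ^+ 2 <= weighted_energy w u.
Proof.
move=> I0; have I0' : (0 < #|I|)%N by rewrite card_gt0.
rewrite /Defs.smallest; case: xgetP => [mu _ [muE mu_lb]|]; last first.
  move=> /(_ (spectrum M)`_0) []; split; first exact: spectrum_eigenvalue.
  by move=> mu /(eigenvalue_bounds I0) /andP[].
split=> // u uB; have /andP[+ _] := rayleigh I0 uB; apply: le_trans.
rewrite ler_wpM2r ?sumr_ge0 // => [v _|]; first exact: sqr_ge0.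
by apply: mu_lb; exact: spectrum_eigenvalue.
Qed.

Lemma largest_dirichlet_eigenvalue : I != finset.set0 ->
  dirichlet_eigenvalues (unit_measure R (T := T)) w B
    (largest (dirichlet_eigenvalues (unit_measure R (T := T)) w B)).
Proof.
move=> I0; have I0' : (0 < #|I|)%N by rewrite card_gt0.
rewrite /largest; case: xgetP => [mu _ []|] //.
move=> /(_ (spectrum M)`_#|I|.-1) []; split.
  by apply: spectrum_eigenvalue; rewrite prednK.
by move=> mu /(eigenvalue_bounds I0) /andP[].
Qed.

End WeightedGraphs.

(** * Eigenvalue bounds for paths *)

Section PathEigenvalues.
Variable R : realType.
Implicit Types (g a : nat -> R) (l : R).

Lemma sum_path_edges n (h : nat -> nat -> R) : (forall x y, h x y = h y x) ->
  \sum_(x < n) \sum_(y < n) (path_edge x y)%:R * h x y =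
  2 * \sum_(0 <= j < n.-1) h j j.+1.
Proof.
move=> h_sym; pose S := \sum_(x < n) \sum_(y < n) (x.+1 == y :> nat)%:R * h x y.
have SE : S = \sum_(0 <= j < n.-1) h j j.+1.
  rewrite /S {S}; case: n => [|m]; first by rewrite big_ord0 big_nil.
  rewrite big_ord_recr /= [X in _ + X]big1 ?addr0 => [|y _]; last first.
    by rewrite gtn_eqF ?mul0r // ltn_ord.
  rewrite big_mkord; apply: eq_bigr => x _.
  have xm : (x.+1 < m.+1)%N by rewrite ltnS ltn_ord.
  rewrite (bigD1 (Ordinal xm)) //= eqxx mul1r big1 ?addr0 // => y.
  by rewrite -val_eqE /= eq_sym => /negPf ->; rewrite mul0r.
have SE' : S = \sum_(x < n) \sum_(y < n) (y.+1 == x :> nat)%:R * h x y.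
  rewrite /S exchange_big; apply: eq_bigr => x _; apply: eq_bigr => y _ /=.
  by rewrite h_sym.
rewrite -SE mulr_natl mulr2n {2}SE' -big_split; apply: eq_bigr => x _.
rewrite -big_split; apply: eq_bigr => y _ /=; rewrite -mulrDl.
have : ~~ ((x.+1 == y :> nat) && (y.+1 == x :> nat)) by lia.
rewrite /path_edge; case: (x.+1 == y :> nat); case: (y.+1 == x :> nat) => //= _.
- by rewrite addr0.
- by rewrite add0r.
- by rewrite addr0.
Qed.

Lemma path_energyE n g :
  weighted_energy (unit_weight R (@path_edge n)) (fun x => g x) =
  \sum_(0 <= j < n.-1) (g j.+1 - g j) ^+ 2.
Proof.
rewrite /weighted_energy /unit_weight.
under eq_bigr do under eq_bigr do rewrite mulrC.
rewrite (sum_path_edges n (h := fun x y => (g x - g y) ^+ 2)) => [|x y].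
  rewrite mulrC mulKf ?pnatr_eq0 //; apply: eq_bigr => j _.
  by rewrite -sqrrN opprB.
by rewrite -sqrrN opprB.
Qed.

Lemma dirichlet_path_energyE k l g :
  weighted_energy (@path_weight R k.+1 l) (fun x => g x) =
  l * (g 1%N - g 0%N) ^+ 2 + \sum_(0 <= j < k) (g j.+2 - g j.+1) ^+ 2.
Proof.
pose h x y := (if (x == 0%N) || (y == 0%N) then l else 1) * (g x - g y) ^+ 2.
have -> : weighted_energy (@path_weight R k.+1 l) (fun x => g x) =
    (\sum_(x < k.+2) \sum_(y < k.+2) (path_edge x y)%:R * h x y) / 2.
  congr (_ / _); apply: eq_bigr => x _; apply: eq_bigr => y _.
  rewrite /path_weight /h; case: (path_edge x y); last by rewrite mulr0 mul0r.
  by rewrite mul1r mulrC.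
rewrite sum_path_edges => [|x y]; last by rewrite /h orbC -sqrrN opprB.
rewrite mulrC mulKf ?pnatr_eq0 //
  big_nat_recl //= {1}/h /= -[(g 0%N - _) ^+ 2]sqrrN opprB.
by congr (_ + _); apply: eq_bigr => j _; rewrite /h /= mul1r -sqrrN opprB.
Qed.

Lemma path_edge_sym n : symmetric (@path_edge n).
Proof. by move=> x y; rewrite /path_edge orbC. Qed.

Lemma path_weight_sym k l x y : @path_weight R k l x y = path_weight l y x.
Proof. by rewrite /path_weight path_edge_sym orbC. Qed.

Lemma lambda_path_eigenfunction n : (0 < n)%N -> exists2 g,
  exists2 j, (j < n)%N & g j != 0 &
  \sum_(0 <= j < n.-1) (g j.+1 - g j) ^+ 2 =
    lambda_path R n * \sum_(0 <= j < n) g j ^+ 2.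
Proof.
case: n => // n _; pose w := unit_weight R (@path_edge n.+1).
have w_sym x y : w x y = w y x by rewrite /w /unit_weight path_edge_sym.
(* Laplacian eigenvalues are treated as Dirichlet eigenvalues with empty boundary. *)
have LE : laplacian_eigenvalues (unit_measure R (T := 'I_n.+1)) w =
    dirichlet_eigenvalues (unit_measure R (T := 'I_n.+1)) w finset.set0.
  apply/seteqP; split=> mu /= [u].
    by move=> [un0 uE]; exists u; split=> // x; rewrite inE.
  by move=> [un0 _ uE]; exists u; split=> // x; apply: uE; rewrite inE.
have [|u [[x ux] _ uE]] := dirichlet_eigenfunction_energy w_sym
    (largest_dirichlet_eigenvalue (B := finset.set0) w_sym _).
  by apply/finset.set0Pn; exists ord0; rewrite !inE.
rewrite -LE in uE; pose g j := u (inord j).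
have ug : u = (fun x : 'I_n.+1 => g x) by apply/funext => y;
  rewrite /g inord_val.
exists g; first by exists x; rewrite // /g inord_val.
by rewrite -path_energyE -ug [LHS]uE big_mkord; congr (_ * _);
  apply: eq_bigr => y _; rewrite ug.
Qed.

(** On each edge (p - q)^2 is at most 2 p^2 + 2 q^2, and every vertex of a path lies on at most two
    edges. *)
Lemma lambda_path_bounds n : (0 < n)%N -> 0 <= lambda_path R n <= 4.
Proof.
case: n => // n _; have [//|g [j jn gj] gE] := @lambda_path_eigenfunction n.+1.
have g0 : 0 < \sum_(0 <= j < n.+1) g j ^+ 2.
  rewrite big_mkord (bigD1 (Ordinal jn)) //= ltr_wpDr ?sumr_ge0 // => [x _|].
    exact: sqr_ge0.
  by rewrite lt0r sqrf_eq0 gj sqr_ge0.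
rewrite -(ler_pM2r g0) -[_ <= 4](ler_pM2r g0) mul0r -gE /= sumr_ge0 =>
  [|x _] /=; last first.
  exact: sqr_ge0.
have gap : \sum_(0 <= j < n) (g j.+1 - g j) ^+ 2 <=
    2 * \sum_(0 <= j < n) g j.+1 ^+ 2 + 2 * \sum_(0 <= j < n) g j ^+ 2.
  rewrite !mulr_sumr -big_split /=; apply: ler_sum => x _.
  have := sqr_ge0 (g x.+1 + g x); rewrite sqrrD sqrrB; lra.
have E1 : \sum_(0 <= j < n.+1) g j ^+ 2 = g 0%N ^+ 2 + \sum_(0 <=
  j < n) g j.+1 ^+ 2.
  by rewrite big_nat_recl.
have E2 : \sum_(0 <= j < n.+1) g j ^+ 2 = \sum_(0 <= j < n) g j ^+ 2 + g n ^+ 2.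
  by rewrite big_nat_recr.
have := sqr_ge0 (g 0%N); have := sqr_ge0 (g n); lra.
Qed.

(** [a j] is the value at vertex [j.+1]; the boundary vertex 0 is joined by the edge of weight [l]
    to the vertex with value [a 0%N]. *)
Lemma dirichlet_path_rayleigh k l a :
  dirichlet_path k.+1 l * \sum_(0 <= j < k.+1) a j ^+ 2 <=
  l * a 0%N ^+ 2 + \sum_(0 <= j < k) (a j.+1 - a j) ^+ 2.
Proof.
have [|_] := smallest_dirichlet_eigenvalue (B := finset.set1 ord0)
    (@path_weight_sym k.+1 l).
  by apply/finset.set0Pn; exists ord_max; rewrite !inE.
pose g j := if j is j'.+1 then a j' else 0.
move=> /(_ (fun x => g x)); rewrite dirichlet_path_energyE subr0.
rewrite -(big_mkord xpredT (fun j => g j ^+ 2)) big_nat_recl //= expr0n add0r.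
by apply => v; rewrite inE => /eqP ->.
Qed.

(** A zero at vertex 1 makes the weighted edge idle and leaves a unit path with [k] edges. *)
Lemma path_bound_dirichlet_path k l : path_bound k (dirichlet_path k.+1 l).
Proof.
move=> a a0; have := dirichlet_path_rayleigh k l a.
by rewrite big_nat_recl // a0 expr0n mulr0 !add0r.
Qed.

Lemma dirichlet_path_lt1 k l : 0 <= l -> dirichlet_path k.+2 l < 1.
Proof.
move=> l0; rewrite ltNge; apply/negP => P1.
have l1 : 0 < 1 + l by rewrite ltr_wpDr.
(* This [t] minimizes [l * t ^+ 2 + (1 - t) ^+ 2], the energy of the test function t, 1, 1, ...; the
   minimum is [1 - t], which is less than the mass. *)
pose t := (1 + l)^-1; have t0 : 0 < t by rewrite invr_gt0.
have t1 : t * (1 + l) = 1 by rewrite mulVf ?lt0r_neq0.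
have tE : l * t = 1 - t by lra.
have := dirichlet_path_rayleigh k.+1 l (fun j => if j is 0%N then t else 1).
rewrite big_nat_recl //= [in X in _ <= X]big_nat_recl //=.
rewrite [X in _ + (_ + X)]big1 ?addr0 => [|j _]; last by rewrite subrr expr0n.
rewrite (eq_bigr (fun=> 1)) => [|j _]; last exact: expr1n.
rewrite sumr_const_nat subn0.
have k1 : 1 <= k.+1%:R :> R by rewrite ler1n.
have t2 : 0 < t ^+ 2 by rewrite exprn_gt0.
have le1 : 1 <= dirichlet_path k.+2 l * (t ^+ 2 + k.+1%:R) by nra.
have -> : l * t ^+ 2 + (1 - t) ^+ 2 = 1 - t by rewrite expr2 mulrA tE; ring.
lra.
Qed.

Lemma sinpiB (x : R) : sin (pi - x) = sin x.
Proof. by rewrite sinB sinpi cospi mul0r sub0r mulN1r opprK. Qed.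

(** For k > 0 and th = pi / (2k + 1), the first eigenfunction is sin (j th): it vanishes at 0, is
    positive for j from 1 to k and takes equal values at k and k + 1, which is the condition at the
    free end. *)
Lemma path_bound_cos k : path_bound k (2 - 2 * cos (pi / (2 * k + 1)%:R) : R).
Proof.
move=> a a0; set th := pi / _; set c := 2 - _.
case: k @th @c => [|k] th c; first by rewrite !big_nil mulr0.
have n0 : 0 < (2 * k.+1 + 1)%:R :> R by rewrite ltr0n addn1.
have th0 : 0 < th by rewrite divr_gt0 ?pi_gt0.
have thE : (2 * k.+1 + 1)%:R * th = pi by rewrite mulrC divfK ?lt0r_neq0.
pose g j := sin (j%:R * th).
have gS j : g j.+2 = 2 * cos th * g j.+1 - g j.
  have -> : g j.+2 = sin (j.+1%:R * th + th).
    by rewrite /g -[j.+2]addn1 natrD mulrDl mul1r.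
  have -> : g j = sin (j.+1%:R * th - th).
    by rewrite /g -[j.+1]addn1 natrD mulrDl mul1r addrK.
  rewrite sinD sinB /g; ring.
have g_end : g k.+2 = g k.+1.
  rewrite /g -sinpiB -thE -mulrBl; congr (sin (_ * _)).
  by rewrite -natrB; [congr _%:R; lia | lia].
have g_gt0 j : (0 < j <= k.+1)%N -> 0 < g j.
  move=> /andP[j0 jk]; apply: sin_gt0_pi; rewrite mulr_gt0 ?ltr0n //= -thE.
  by rewrite ltr_pM2r // ltr_nat; lia.
(* Picone: the ratios rho of consecutive values of the eigenfunction give the
   weights for which every square below is exact. *)
pose rho j := g j.+1 / g j.
have step m : (m <= k)%N ->
  (rho m.+1 - 1) * a m.+1 ^+ 2 + c * \sum_(0 <= j < m.+1) a j.+1 ^+ 2 <=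
  \sum_(0 <= j < m.+1) (a j.+1 - a j) ^+ 2.
  elim: m => [_|m IHm mk].
    rewrite !big_nat1 a0 subr0 /rho gS {2}/g mul0r sin0 subr0 mulfK ?lt0r_neq0
      ?g_gt0 //.
    by rewrite /c; lra.
  rewrite ![\sum_(0 <= j < m.+2) _]big_nat_recr //= mulrDr.
  have {}IHm := IHm (ltnW mk).
  have g1 : 0 < g m.+1 by apply: g_gt0; lia.
  have g2 : 0 < g m.+2 by apply: g_gt0; lia.
  have r0 : 0 < rho m.+1 by rewrite divr_gt0.
  have rE : rho m.+2 = 2 - c - (rho m.+1)^-1.
    rewrite /rho gS /c invf_div; field; exact: lt0r_neq0.
  have sq : 0 <= rho m.+1 * (a m.+1 - (rho m.+1)^-1 * a m.+2) ^+ 2.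
    by rewrite mulr_ge0 ?sqr_ge0 // ltW.
  have sqE : rho m.+1 * (a m.+1 - (rho m.+1)^-1 * a m.+2) ^+ 2 =
      rho m.+1 * a m.+1 ^+ 2 - 2 * a m.+1 * a m.+2 +
        (rho m.+1)^-1 * a m.+2 ^+ 2.
    by field; exact: lt0r_neq0.
  rewrite sqE in sq; rewrite rE; move: IHm sq; set r := (rho m.+1)^-1; lra.
(* At the free end the ratio is 1, so the term in [a k.+1] drops out. *)
have := step k (leqnn k).
by rewrite /rho g_end divff ?lt0r_neq0 ?g_gt0 ?leqnn // subrr mul0r add0r.
Qed.

Lemma cos_bound_gt0 k : (0 < k)%N -> 0 < 2 - 2 * cos (pi / (2 * k + 1)%:R) :> R.
Proof.
move=> k0; set th := pi / _.
have n0 : 1 < (2 * k + 1)%:R :> R by rewrite ltr1n; lia.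
have th0 : 0 < th < pi.
  rewrite divr_gt0 ?pi_gt0 ?(lt_trans ltr01) //=
    ltr_pdivrMr ?(lt_trans ltr01) //.
  by rewrite ltr_pMr ?pi_gt0.
have s0 := sin_gt0_pi th0; have := cos2Dsin2 th; have := cos_le1 th; nra.
Qed.

Lemma cos_bound1 : 2 - 2 * cos (pi / (2 * 1 + 1)%:R) = 1 :> R.
Proof.
set th : R := pi / _; have thE : th *+ 2 = pi - th.
  (* From 2 th = pi - th follows sin (2 th) = sin th, which gives cos th = 1/2. *)
  have : 3 * th = pi by rewrite mulrC divfK // pnatr_eq0.
  by rewrite mulr2n; lra.
have th0 : 0 < th < pi.
  by rewrite divr_gt0 ?pi_gt0 ?ltr0n //= ltr_pdivrMr ?ltr0n //
    ltr_pMr ?pi_gt0 ?ltr1n.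
have := sin_mulr2n th; rewrite thE sinpiB => E.
have s0 := sin_gt0_pi th0.
suff : cos th * 2 = 1 by lra.
by apply: (mulfI (lt0r_neq0 s0)); rewrite {2}E; ring.
Qed.

Lemma path_bound_lt1 k (c : R) : (1 < k)%N -> path_bound k c -> c < 1.
Proof.
(* The sequence 0, 1, 1, ... has energy 1 and mass [k], which is at least 2. *)
move=> k1 /(_ (fun j => (j != 0%N)%:R) erefl).
case: k k1 => // k k1; rewrite [in X in _ <= X]big_nat_recl //=.
rewrite (eq_bigr (fun=> 1)) => [|j _]; last exact: expr1n.
rewrite [X in _ <= _ + X]big1 => [|j _]; last by rewrite subrr expr0n.
rewrite sumr_const_nat subn0 => H; rewrite ltNge; apply/negP => c1.
have k2 : 2 <= k.+1%:R :> R by rewrite ler_nat.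
nra.
Qed.

End PathEigenvalues.

(** * The two lower bounds, and the star as the case of equality *)

Local Open Scope classical_set_scope.
Local Open Scope ring_scope.

Theorem theorem1p3 (R : realType) (V : finType) (e : rel V) (B : {set V})
    (i : nat)
    (hG : simple_graph e) (hconn : connected_graph e)
    (hB : graph_boundary e B) (hi2 : (2 <= i)%N) (hiB : (i <= #|B|)%N) :
  let sigma_i :=
    steklov_eigenvalue (unit_measure R (T := V)) (unit_weight R e) B i in
  let k := (#|V| %/ i)%N in
  (~~ (i %| #|V|)%N ->
     2 - 2 * cos (pi / (2 * k + 1)%:R) <= sigma_i /\
     (#|V| = 1 %[mod i] ->
        (sigma_i = 2 - 2 * cos (pi / (2 * k + 1)%:R) <->
         k = 1%N /\ star_with_boundary e B i))) /\
  ((i %| #|V|)%N -> dirichlet_path k (lambda_path R i) < sigma_i).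
Proof.
move=> sigma_i k; have [e_sym e_irr] := hG; have [B0 Bind Badj] := hB.
have i0 : (0 < i)%N by lia.
have iB : (0 < i <= #|B|)%N by rewrite i0.
have [b bB] : exists b, b \in B by apply/finset.set0Pn.
have [ctr ctrB ebo] := Badj b bB.
have ltBV : (#|B| < #|V|)%N.
  rewrite -[#|V|]finset.cardsT; apply/proper_card/fintype.properP.
  by split; [exact: finset.subsetT | exists ctr; rewrite ?finset.in_setT].
have k0 : (0 < k)%N by rewrite divn_gt0 //; lia.
have Vlt : (#|V| < k.+1 * i)%N by rewrite ltn_ceil.
have c0 := cos_bound_gt0 R k0; have ck := @path_bound_cos R k.
have cb := cut_bound_connected e_sym b hconn (ltW c0) ck hi2 Vlt.
have sigma_ge := steklov_ge e_sym hconn hB iB (ltW c0) cb.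
split=> [ndiv|div].
  split=> // V1; split=> [sE|[k1 star]]; last first.
    apply/eqP; rewrite eq_le sigma_ge andbT k1 cos_bound1.
    exact: (steklov_star_le1 R e_sym hconn hB iB star).
  have k1 : k = 1%N.
    (* For [1 < k] the bound lies strictly between 0 and 1, where [steklov_gt] excludes equality. *)
    apply/eqP; rewrite eqn_leq k0 andbT leqNgt; apply/negP => k1.
    have := steklov_gt e_sym hconn hB iB _ cb.
    by rewrite c0 (path_bound_lt1 k1 ck) -/sigma_i sE ltxx => /(_ isT).
  split=> //; have Vi : #|V| = i.+1.
    by rewrite (divn_eq #|V| i) -/k k1 V1 modn_small ?mul1n ?addn1.
  (* From [i <= #|B| < i.+1], the only interior vertex is [ctr], so every boundary vertex is
     adjacent to it. *)
  have cB : #|B| = i by lia.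
  have BE : B = finset.setC (finset.set1 ctr).
    apply/eqP; rewrite finset.eqEcard finset.cardsC1 Vi cB leqnn andbT.
    apply/fintype.subsetP => x xB; rewrite !finset.inE.
    by apply: contraNneq ctrB => <-.
  have inB x : (x \in B) = (x != ctr) by rewrite BE !finset.inE.
  exists ctr; split; rewrite -?BE // => x y.
  have [-> | xo] := eqVneq x ctr; have [-> | yo] := eqVneq y ctr => /=.
  - exact: e_irr.
  - have yB : y \in B by rewrite inB.
    have [z zB eyz] := Badj y yB; move: zB; rewrite inB negbK => /eqP zo.
    by rewrite e_sym -zo.
  - have xB : x \in B by rewrite inB.
    by have [z zB exz] := Badj x xB; move: zB; rewrite inB negbK => /eqP <-.
  - by apply/negbTE/Bind; rewrite inB.
have VE : #|V| = (k * i)%N by rewrite divnK.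
(* The quotient is at least 2 because [i <= #|B| < #|V|]. The pieces have [k = k'.+2] vertices, so
   the cutting lemmas are used with parameter [k'.+1]. *)
have [k' kE] : exists k', k = k'.+2.
  exists k.-2; have : (1 < k)%N by rewrite -(ltn_pmul2r i0) mul1n -VE; lia.
  by lia.
have l04 := lambda_path_bounds R i0; have /andP[l0 _] := l04.
have P1 := dirichlet_path_lt1 k' l0; rewrite -kE in P1.
(* A nonpositive value is settled by the positive cosine bound; [steklov_gt] treats the positive
   case. *)
have [P0|P0] := lerP (dirichlet_path k (lambda_path R i)) 0.
  exact: le_lt_trans P0 (lt_le_trans c0 sigma_ge).
apply: (steklov_gt e_sym hconn hB iB); first by rewrite P0.
have [g gj gE] := lambda_path_eigenfunction R i0.
apply: (cut_bound_divisible e_sym b (k := k'.+1) (l :=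
  lambda_path R i) (g := g)) => //.
- by rewrite (ltW P0) (ltW P1).
- by rewrite kE; exact: path_bound_dirichlet_path.
- by rewrite kE; exact: dirichlet_path_rayleigh.
- by rewrite gE.
- by rewrite VE kE.
Qed.
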